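(* Let $p\in(1,2]$ and $m\in(-\infty,\infty)$. Let $$L=(1+|x|)^m\Delta\quad\text{in }\mathbb R^d,$$ $\beta=0$, and $$\alpha(x)\ge c(1+|x|)^{m-2},\qquad x\in\mathbb R^d,$$ for some $c>0$. Then the compact support property holds for the measure-valued process $X(t)$ corresponding to $(L,\beta,\alpha,p)$. However, if $m>2$ and $d\ge3$, the diffusion process $Y(t)$ corresponding to $L$ on $\mathbb R^d$ explodes.
   Context: Standing assumption. $\alpha>0$ is locally Hölder continuous on $\mathbb R^d$. The diffusion. $Y(t)$ is the diffusion process corresponding to the generalized martingale problem for $L$ on $\mathbb R^d$, with probabilities $\mathcal P_x$. Its lifetime is $\tau_\infty=\lim_{n\to\infty}\tau_n$, $\tau_n=\inf\{t\ge0:|Y(t)|\ge n\}$. $Y(t)$ is non-explosive if $\mathcal P_x(\tau_\infty<\infty)=0$ for some, or equivalently all, $x\in\mathbb R^d$; otherwise it is explosive (''explodes''). The measure-valued process. The process $X(t)$ corresponding to $(L,\beta,\alpha,p)$, $p\in(1,2]$, is the Markov process (with càdlàg paths) taking values in the space $\mathcal M_F(\mathbb R^d)$ of finite measures on $\mathbb R^d$, defined uniquely by $$E\big(\exp(-\langle f,X(t)\rangle)\,\big|\,X(0)=\mu\big)=\exp(-\langle u_f(\cdot,t),\mu\rangle),$$ for all nonnegative continuous compactly supported $f$ on $\mathbb R^d$ and all finite measures $\mu$, where $u_f$ is the minimal positive (classical) solution of $u_t=Lu+\beta u-\alpha u^p$ in $\mathbb R^d\times(0,\infty)$, $u(x,0)=f(x)$,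 $u\ge0$. $P_\mu$ denotes the law of the process started from $\mu$. Compact support property. It holds for the process started from a compactly supported finite measure $\mu$ if $P_\mu\big(\bigcup_{0\le s\le t}\operatorname{supp}X(s)\text{ is bounded}\big)=1$ for all $t\ge0$. It is said to hold for $X(t)$ if this is so for one, or equivalently all, nonzero compactly supported finite initial measures $\mu$. *)

(* Defs.v *)
From HB Require Import structures.
From mathcomp Require Import all_boot all_order all_algebra.
From mathcomp Require Import all_classical all_reals all_analysis.
From mathcomp Require Import measurable_realfun one_point_compactification.

Set Implicit Arguments.
Unset Strict Implicit.
Unset Printing Implicit Defensive.

Import Order.TTheory GRing.Theory Num.Theory.
Import numFieldNormedType.Exports.

Local Open Scope classical_set_scope.
Local Open Scope ring_scope.

Section Euclidean.
Context {R : realType} {d : nat}.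
Implicit Types (f : 'rV[R]_d -> R) (x : 'rV[R]_d).

(** The library norm [`|x|] of ['rV[R]_d] is the sup norm. *)
Definition enorm x : R := Num.sqrt (\sum_(i < d) x 0 i ^+ 2).

Definition partial (i : 'I_d) f : 'rV[R]_d -> R := 'D_(delta_mx 0 i) f.

Definition laplacian f x : R := \sum_(i < d) partial i (partial i f) x.

Definition weighted_laplacian (m : R) f x : R :=
  (1 + enorm x) `^ m * laplacian f x.

Definition C2 f : Prop :=
  [/\ continuous f,
      forall (i : 'I_d) x, derivable f x (delta_mx 0 i),
      forall i, continuous (partial i f),
      forall (i j : 'I_d) x, derivable (partial i f) x (delta_mx 0 j) &
      forall i j, continuous (partial j (partial i f))].

(** Exponent and constant may depend on the ball. *)
Definition locally_Hoelder f : Prop :=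
  forall r : R, exists (gamma C : R), 0 < gamma <= 1 /\
    forall x y, enorm x <= r -> enorm y <= r ->
      `|f x - f y| <= C * enorm (x - y) `^ gamma.

Definition Cb f : Prop := continuous f /\ exists M : R, forall x, `|f x| <= M.

Definition Ccp f : Prop :=
  [/\ continuous f, forall x, 0 <= f x & compact (closure [set x | f x != 0])].

End Euclidean.

Section Cauchy.
Context {R : realType} {d : nat}.
Variables (L : ('rV[R]_d -> R) -> 'rV[R]_d -> R) (beta alpha : 'rV[R]_d -> R).
Variable (p : R).
Implicit Types (u v : 'rV[R]_d -> R -> R) (f : 'rV[R]_d -> R).

(** [C^{2,1}(R^d x (0,oo))] and [C(R^d x [0,oo))]; the continuity
    requirements are joint in [(x, t)]. *)
Definition parabolic_regular u : Prop :=
  {within [set z : 'rV[R]_d * R | 0 <= z.2], continuous (fun z => u z.1 z.2)} /\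
  forall x (t : R), 0 < t ->
    [/\ derivable (u x) t 1 /\
          {for (x, t), continuous (fun z : 'rV[R]_d * R => derive1 (u z.1) z.2)},
        forall i : 'I_d, derivable (u^~ t) x (delta_mx 0 i),
        forall i, {for (x, t), continuous
          (fun z : 'rV[R]_d * R => partial i (u^~ z.2) z.1)},
        forall i j : 'I_d, derivable (partial i (u^~ t)) x (delta_mx 0 j) &
        forall i j, {for (x, t), continuous
          (fun z : 'rV[R]_d * R => partial j (partial i (u^~ z.2)) z.1)}].

Definition nonneg_solution f u : Prop :=
  [/\ parabolic_regular u,
      forall x (t : R), 0 <= t -> 0 <= u x t,
      forall x, u x 0 = f x &
      forall x (t : R), 0 < t ->
        derive1 (u x) t = L (u^~ t) x + beta x * u x t - alpha x * u x t `^ p].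

Definition minimal_solution f u : Prop :=
  nonneg_solution f u /\
  forall v, nonneg_solution f v -> forall x (t : R), 0 <= t -> u x t <= v x t.

End Cauchy.

Definition borel (T : ptopologicalType) := g_sigma_algebraType (@open T).

Definition finite_measures (R : realType) (d : nat) : Type :=
  {finite_measure set (borel 'rV[R]_d) -> \bar R}.

Section FiniteMeasures.
Context {R : realType} {d : nat}.
Local Notation MF := (finite_measures R d).

HB.instance Definition _ := gen_eqMixin MF.
HB.instance Definition _ := gen_choiceMixin MF.
HB.instance Definition _ := isPointed.Build MF mzero.

Definition MF_measurable : set (set MF) :=
  <<s \bigcup_(B in (measurable : set (set (borel 'rV[R]_d))))
        preimage_set_system [set: MF] (fun mu : MF => mu B) measurable >>.

Let MF_measurable0 : MF_measurable set0.
Proof. exact: sigma_algebra0. Qed.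

Let MF_measurableC (U : set MF) : MF_measurable U -> MF_measurable (~` U).
Proof. exact: sigma_algebraC. Qed.

Let MF_measurableU (F : (set MF)^nat) :
  (forall i, MF_measurable (F i)) -> MF_measurable (\bigcup_i F i).
Proof. exact: sigma_algebra_bigcup. Qed.

Definition MF_display : measure_display.
Proof. by constructor. Qed.

HB.instance Definition _ := @isMeasurable.Build MF_display MF MF_measurable
  MF_measurable0 MF_measurableC MF_measurableU.

Definition pairing (f : 'rV[R]_d -> R) (mu : MF) : \bar R :=
  \int[mu]_x (f x)%:E.

Definition measure_support (mu : MF) : set 'rV[R]_d :=
  [set x | forall U : set 'rV[R]_d, open U -> U x -> (0 < mu U)%E].

Definition weak_cvg (F : set_system R) (nu : R -> MF) (mu : MF) : Prop :=
  forall f, Cb f -> pairing f (nu s) @[s --> F] --> pairing f mu.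

(** Only the restriction of a path to [[0, oo)] is relevant. *)
Definition cadlag (nu : R -> MF) : Prop :=
  (forall t : R, 0 <= t -> weak_cvg t^'+ nu (nu t)) /\
  (forall t : R, 0 < t -> exists mu, weak_cvg t^'- nu mu).

End FiniteMeasures.

Section Filtrations.
Context {R : realType} {dO : measure_display} {Omega : measurableType dO}.

Definition natural_filtration {dT : measure_display} {T : measurableType dT}
    (Z : R -> Omega -> T) (t : R) : set_system Omega :=
  <<s [set A | exists (r : R) B, [/\ 0 <= r <= t, measurable B & A = Z r @^-1` B]] >>.

Definition martingale (P : probability Omega R) (F : R -> set_system Omega)
    (M : R -> Omega -> R) : Prop :=
  (forall t : R, 0 <= t ->
     P.-integrable setT (EFin \o M t) /\
     forall B, measurable B -> F t (M t @^-1` B)) /\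
  (forall (s t : R) A, 0 <= s <= t -> F s A ->
     (\int[P]_(w in A) (M t w)%:E = \int[P]_(w in A) (M s w)%:E)%E).

End Filtrations.

Section Superprocess.
Context {R : realType} {d : nat}.
Context {dO : measure_display} {Omega : measurableType dO}.
Local Notation MF := (finite_measures R d).
Variables (P : MF -> probability Omega R) (X : R -> Omega -> MF).

(** [mu] and [X 0 w] are compared on Borel sets only, as a library measure also
    takes (meaningless) values on nonmeasurable sets. *)
Record superprocess (L : ('rV[R]_d -> R) -> 'rV[R]_d -> R)
    (beta alpha : 'rV[R]_d -> R) (p : R) : Prop := {
  superprocess_measurable :
    forall t : R, 0 <= t -> measurable_fun setT (X t) ;
  superprocess_cadlag : forall w, cadlag (X^~ w) ;
  superprocess_start : forall mu : MF, {ae P mu, forall w,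
    forall B : set (borel 'rV[R]_d), measurable B -> X 0 w B = mu B} ;
  superprocess_kernel : forall (t : R) (G : set MF), 0 <= t -> measurable G ->
    measurable_fun setT (fun mu : MF => P mu (X t @^-1` G)) ;
  superprocess_Markov : forall (mu : MF) (s t : R) (G : set MF) (A : set Omega),
    0 <= s -> 0 <= t -> measurable G -> natural_filtration X s A ->
    P mu (A `&` X (s + t) @^-1` G) =
      (\int[P mu]_(w in A) P (X s w) (X t @^-1` G))%E ;
  superprocess_Laplace : forall f, Ccp f ->
    exists2 u, minimal_solution L beta alpha p f u &
      forall (mu : MF) (t : R), 0 <= t ->
        (\int[P mu]_w expeR (- pairing f (X t w)) =
         expeR (- pairing (u^~ t) mu))%E
}.

(** The event is measurable when the paths of [X] are weakly cadlag and each
    [X t] is measurable. *)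
Definition compact_support_from (mu : MF) : Prop :=
  forall t : R, 0 <= t ->
    P mu [set w | bounded_set (\bigcup_(s in `[0, t]) measure_support (X s w))] = 1%E.

(** It does not depend on the choice of [mu]; the universal form is taken. *)
Definition compact_support_property : Prop :=
  forall mu : MF, (0 < mu setT)%E -> compact (measure_support mu) ->
    compact_support_from mu.

End Superprocess.

Section Diffusion.
Context {R : realType} {d : nat}.
Context {dO : measure_display} {Omega : measurableType dO}.
(** The point at infinity [None] is the cemetery. *)
Local Notation E := (one_point_compactification 'rV[R]_d).

Definition extend (f : 'rV[R]_d -> R) (y : E) : R :=
  if y is Some x then f x else 0.

Definition E_norm (y : E) : \bar R :=
  if y is Some x then (enorm x)%:E else +oo%E.

Variables (P : 'rV[R]_d -> probability Omega R) (Y : R -> Omega -> E).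

Definition exit_time (n : nat) (w : Omega) : \bar R :=
  ereal_inf
    [set t%:E | t in [set t : R | 0 <= t /\ (n%:R%:E <= E_norm (Y t w))%E]].

Definition lifetime (w : Omega) : \bar R := limn (exit_time^~ w).

Definition stopped_time (n : nat) (t : R) (w : Omega) : R :=
  fine (Order.min t%:E (exit_time n w)).

(** A solution [(P x)_x] of the generalized martingale problem for [L] on
    [R^d]: explosion is allowed, so the martingale property is only required
    up to the exit times from balls. *)
Record diffusion (L : ('rV[R]_d -> R) -> 'rV[R]_d -> R) : Prop := {
  diffusion_measurable : forall t : R, 0 <= t ->
    measurable_fun setT (Y t : Omega -> borel E) ;
  diffusion_continuous : forall w,
    {within [set t : R | 0 <= t], continuous (Y^~ w)} ;
  diffusion_absorbed : forall w (s t : R), 0 <= s <= t ->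
    Y s w = None -> Y t w = None ;
  diffusion_start : forall x, P x (Y 0 @^-1` [set Some x]) = 1%E ;
  diffusion_martingale : forall x n f, C2 f ->
    martingale (P x) (natural_filtration (Y : R -> Omega -> borel E))
      (fun t w => extend f (Y (stopped_time n t w) w) -
         \int[lebesgue_measure]_(s in `[0, stopped_time n t w])
            extend (L f) (Y s w))
}.

(** The lifetime is a.s. infinite for one [x] iff it is for all [x]; stating
    this with [exists] gives the stronger meaning to [explosive]. *)
Definition nonexplosive : Prop :=
  exists x, P x [set w | (lifetime w < +oo)%E] = 0%E.

Definition explosive : Prop := ~ nonexplosive.

End Diffusion.

(* Main.v *)
Require Import Defs.
From HB Require Import structures.
From mathcomp Require Import all_boot all_order all_algebra.
From mathcomp Require Import all_classical all_reals all_analysis.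
From mathcomp Require Import measurable_realfun one_point_compactification.
From mathcomp Require Import lra ring.

(** Both halves rest on one explicit function of [rho x = 1 + |x|^2].

    Compact support.  For [S > 0] put
    [W_S(x) = K_S (S - ln (rho x)) ^ (- 2 / (p - 1))] on the ball
    [ln (rho x) < S].  The derivatives of [ln rho] of orders one and two are of
    order [rho^(-1/2)] and [rho^(-1)], so [(1 + |x|)^m Lap W_S] is at most a
    multiple of [(1 + |x|)^(m-2) W_S^p], and the lower bound on [alpha] makes
    [W_S] a stationary supersolution once [K_S ^ (p - 1)] is a suitable affine
    function of [S].  This barrier blows up on the boundary of its ball, so the
    maximum principle on a slightly smaller ball, where nothing is asked of the
    boundary values beyond local boundedness, shows that every nonnegative
    solution whose initial value is below [W_S] stays below it
    ([solution_le_barrier]).  Whatever the growth of the diffusion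
    coefficient, [W_S] tends to 0 locally uniformly as [S] tends to infinity,
    because [K_S] only grows like [S ^ (1 / (p - 1))] ([barrier_vanishes]).

    Let [W_S] be infinite off the ball.  Testing the Laplace functional against
    compactly supported functions that increase to [W_S], the previous bound
    becomes [E_nu exp (- <W_S, X_t>) >= exp (- <W_S, nu>)]
    ([survival_submartingale]).  The integrand vanishes as soon as [X_t] charges
    the outside of the ball; hence, iterating with the Markov property along a
    finite grid of times, the probability that [X] charges the outside at no
    time of the grid is at least [exp (- <W_S, mu>)]
    ([survival_le_grid_event]).  This bound does not depend on the grid.
    Refining dyadic grids and using right continuity of the paths extends it to
    all times of [[0, t]] at once, and it tends to 1 as [S] tends to infinity
    when [mu] has compact support ([superprocess_compact_support]).

    Explosion.  For [d >= 3], [m > 2] and a small [gam > 0], the bounded function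
    [g = rho ^ (- gam)] satisfies [L g <= - gam]
    ([weighted_laplacian_radial_power_le]).  By the martingale property the mean
    of [t /\ tau_n] is at most [1 / gam], uniformly in [n] and [t], which is
    incompatible with an almost surely infinite lifetime
    ([lyapunov_explosive]). *)

Import Order.TTheory GRing.Theory Num.Theory.
Import numFieldNormedType.Exports.

Set Implicit Arguments.
Unset Strict Implicit.
Unset Printing Implicit Defensive.

Local Open Scope classical_set_scope.
Local Open Scope ring_scope.

(** * Calculus along lines and of radial functions *)

Section DirectionalDerivatives.
Context {R : realType} {V : normedModType R}.
Implicit Types (f : V -> R) (x v : V).

Lemma is_derive_line f x v (s df : R) :
  is_derive (s *: v + x) v f df ->
  is_derive s 1 (fun h : R => f (h *: v + x)) df.
Proof.
case=> fd fE.
have E : (fun h : R => h^-1 *: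
    (((fun h : R => f (h *: v + x)) \o shift s) (h *: (1:R)) - f (s *: v + x)))
  = (fun h => h^-1 *: ((f \o shift (s *: v + x)) (h *: v) - f (s *: v + x))).
  by apply/funext => h /=; rewrite [_%:A]mulr1 scalerDl addrA.
by split; rewrite /derivable /derive /= E.
Qed.

Lemma is_derive_comp_dir (H : R -> R) f x v (dH df : R) :
  differentiable f x -> is_derive x v f df -> is_derive (f x) 1 H dH ->
  is_derive x v (fun y => H (f y)) (dH * df).
Proof.
move=> fd [_ fE] [Hd HE].
have Hd' : differentiable H (f x) by apply/derivable1_diffP.
have cd : differentiable (H \o f) x by exact: differentiable_comp.
split; first exact: diff_derivable.
rewrite (deriveE _ cd) diff_comp//= -(deriveE _ fd) fE (deriv1E Hd) /=.
by rewrite derive1E HE mulrC.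
Qed.

End DirectionalDerivatives.

(** Only the directional second derivatives that make up the Laplacian are
    controlled at a maximum, so the test is one-dimensional.  If [k2 > 0] then
    [k1] is positive just to the right of its zero 0, and the mean value theorem
    gives a value of [k] above [k 0]. *)
Lemma second_derivative_at_max {R : realType} (k k1 : R -> R) (k2 r : R) :
  0 < r -> (forall s : R, `|s| < r -> is_derive s 1 k (k1 s)) ->
  is_derive (0 : R) 1 k1 k2 -> (forall s, `|s| < r -> k s <= k 0) -> k2 <= 0.
Proof.
move=> r0 kd [k1d k1E] kmax.
have in_r t : t \in `](- r), r[ -> `|t| < r by rewrite in_itv /= ltr_norml.
have k10 : k1 0 = 0.
  have z0 : `|0 : R| < r by rewrite normr0.
  have rr : - r <= r by lra.
  have dk t : t \in `](- r), r[ -> derivable k t 1.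
    by move=> /in_r /kd [].
  have [] := @derive1_at_max R k (-r) r 0 rr dk _ _.
  - by rewrite in_itv /= r0 oppr_lt0 r0.
  - by move=> t /in_r; exact: kmax.
  - by move=> _; case: (kd 0 z0) => _ ->.
rewrite leNgt; apply/negP => k2_gt0.
have : \forall h \near 0^', 0 < h^-1 * k1 h.
  have c : h^-1 * k1 h @[h --> (0 : R)^'] --> k2.
    rewrite -k1E; move: k1d; rewrite /derivable => /cvg_ex[l cl].
    rewrite /derive (cvg_lim _ cl)//; apply: cvg_trans cl.
    apply: near_eq_cvg; near=> h.
    by rewrite /= addr0 [_%:A]mulr1 k10 subr0.
  exact: (cvgr_gt k2 c).
move=> /nbhs_ballP[e /= e0 He].
pose h := Num.min e r / 2.
have m0 : 0 < Num.min e r by rewrite lt_min e0 r0.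
have h0 : 0 < h by rewrite divr_gt0.
have he : h < e by apply: (@lt_le_trans _ _ (Num.min e r)); [rewrite /h; lra|rewrite ge_min lexx].
have hr : h < r.
  by apply: (@lt_le_trans _ _ (Num.min e r)); [rewrite /h; lra|rewrite ge_min lexx orbT].
have [||c] := @MVT R k k1 0 h h0.
- by move=> x; rewrite in_itv /= => /andP[x0 xh]; apply: kd; rewrite gtr0_norm//; lra.
- apply: derivable_within_continuous => x; rewrite in_itv /= => /andP[x0 xh].
  by have [] := kd x _; rewrite ?ger0_norm//; lra.
rewrite in_itv /= => /andP[c0 ch] E.
have := kmax h; rewrite gtr0_norm// => /(_ hr).
have : 0 < k1 c.
  have := He c; rewrite /ball /= sub0r normrN gtr0_norm// => /(_ (lt_trans ch he)).
  by move=> /(_ (lt0r_neq0 c0)); rewrite pmulr_rgt0// invr_gt0.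
move=> k1c; have : 0 < k1 c * (h - 0) by rewrite mulr_gt0// subr0.
by rewrite -E; lra.
Unshelve. all: by end_near. Qed.

Section Radial.
Context {R : realType} {d : nat}.
Implicit Types (x y : 'rV[R]_d) (H : R -> R).

(** A smooth substitute for [(1 + |x|)^2], to which it is comparable
    ([rho_le_sqr], [sqr_le_rho]): radial functions are written as functions of
    [rho]. *)
Definition rho x : R := 1 + enorm x ^+ 2.

Lemma enorm_ge0 x : 0 <= enorm x. Proof. exact: sqrtr_ge0. Qed.

Lemma enorm_sqr x : enorm x ^+ 2 = \sum_(i < d) x 0 i ^+ 2.
Proof. by rewrite sqr_sqrtr// sumr_ge0// => i _; rewrite sqr_ge0. Qed.

Lemma rhoE : rho = (fun=> 1) + \sum_(i < d) (fun x => x 0 i) ^+ 2.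
Proof.
by apply/funext => x; rewrite /rho enorm_sqr fctE fct_sumE.
Qed.

Lemma rho_ge1 x : 1 <= rho x.
Proof. by rewrite lerDl sqr_ge0. Qed.

Lemma rho_gt0 x : 0 < rho x.
Proof. exact: lt_le_trans (rho_ge1 x). Qed.

Lemma rho_le_sqr x : rho x <= (1 + enorm x) ^+ 2.
Proof. by rewrite /rho; have := enorm_ge0 x; nra. Qed.

Lemma sqr_le_rho x : (1 + enorm x) ^+ 2 <= 2 * rho x.
Proof. by rewrite /rho; have := sqr_ge0 (1 - enorm x); nra. Qed.

Lemma enorm_le_rho x : enorm x <= rho x.
Proof. by rewrite /rho; have := sqr_ge0 (1 - enorm x); nra. Qed.

Lemma coord_le_enorm x i : `|x 0 i| <= enorm x.
Proof.
rewrite -(ler_pXn2r (n := 2)) ?nnegrE ?enorm_ge0// enorm_sqr (bigD1 i)//=.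
by rewrite real_normK ?num_real// lerDl sumr_ge0// => j _; rewrite sqr_ge0.
Qed.

Lemma differentiable_rho x : differentiable rho x.
Proof.
rewrite rhoE; apply: differentiableD => //.
by apply: differentiable_sum => i; apply: differentiableX; exact: differentiable_coord.
Qed.

Lemma continuous_rho : continuous rho.
Proof. by move=> x; exact: differentiable_continuous (differentiable_rho x). Qed.

Lemma continuous_enorm : continuous (enorm : 'rV[R]_d -> R).
Proof.
move=> x; rewrite (_ : enorm = fun y => Num.sqrt (rho y - 1)); last first.
  apply/funext => y; rewrite /rho [1 + _]addrC addrK sqrtr_sqr ger0_norm//.
  exact: enorm_ge0.
apply: continuous_comp; last exact: sqrt_continuous.
exact: (cvgB (@continuous_rho x) (cvg_cst _)).
Qed.

Global Instance is_derive_coord x (i j : 'I_d) :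
  is_derive x (delta_mx 0 i) (fun y : 'rV[R]_d => y 0 j) (i == j)%:R.
Proof.
have E : (fun h : R => h^-1 *: (((fun y : 'rV[R]_d => y 0 j) \o shift x)
    (h *: delta_mx 0 i) - x 0 j)) @ 0^' --> ((i == j)%:R : R).
  apply: (@cvg_trans _ (cst (i == j)%:R @ (0 : R)^')); last exact: cvg_cst.
  apply: near_eq_cvg; near=> h.
  rewrite /= !mxE eqxx /= addrK eq_sym scalerA mulVf ?scale1r//.
  near: h; exact: nbhs_dnbhs_neq.
by split; [apply/cvg_ex; eexists; exact: E | exact: cvg_lim E].
Unshelve. all: by end_near. Qed.

Lemma is_derive_rho x (i : 'I_d) : is_derive x (delta_mx 0 i) rho (2 * x 0 i).
Proof.
rewrite rhoE; apply: is_derive_eq.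
rewrite add0r (bigD1 i)//= big1 ?addr0.
  by rewrite eqxx expr1 /GRing.scale /= mulr1 mulr_natl.
by move=> j /negbTE; rewrite eq_sym => ->; rewrite scaler0.
Qed.

Lemma is_derive_radial H x (i : 'I_d) (dH : R) :
  is_derive (rho x) 1 H dH ->
  is_derive x (delta_mx 0 i) (fun y => H (rho y)) (2 * x 0 i * dH).
Proof.
move=> HH; rewrite mulrC.
exact: (is_derive_comp_dir (differentiable_rho x) (is_derive_rho x i) HH).
Qed.

Lemma is_derive_radial2 H1 x (i j : 'I_d) (dH : R) :
  is_derive (rho x) 1 H1 dH ->
  is_derive x (delta_mx 0 j) (fun y => 2 * y 0 i * H1 (rho y))
    (2 * (j == i)%:R * H1 (rho x) + 4 * x 0 i * x 0 j * dH).
Proof.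
move=> HH; have D := is_derive_radial j HH.
rewrite (_ : (fun y => _) =
  2 *: ((fun y : 'rV[R]_d => y 0 i) * (fun y => H1 (rho y)))); last first.
  by apply/funext => y; rewrite !fctE /= [RHS]/GRing.scale /= mulrA.
apply: is_derive_eq; rewrite /GRing.scale /=; ring.
Qed.

(** The sum of the second derivatives [2 H' + 4 x_i^2 H''] of [H \o rho], with
    [a] and [b] standing for [H' (rho x)] and [H'' (rho x)]. *)
Lemma radial_laplacian_sum x (a b : R) :
  \sum_(i < d) (2 * a + 4 * x 0 i ^+ 2 * b) = d%:R * (2 * a) + 4 * (rho x - 1) * b.
Proof.
rewrite big_split /= sumr_const card_ord; congr (_ + _).
  by rewrite -[LHS]mulr_natl.
rewrite -mulr_suml -mulr_sumr /rho enorm_sqr; congr (_ * _ * _); lra.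
Qed.

End Radial.

(** * The maximum principle *)

Section Comparison.
Context {R : realType} {d : nat}.
Implicit Types (x y : 'rV[R]_d) (t : R).

(** The maximum over [[0, T]] may be attained at the endpoint [T], where only
    earlier times can be compared. *)
Lemma derive1_ge0_at_left_max (g : R -> R) (t0 r : R) :
  0 < r -> derivable g t0 1 -> (forall s, t0 - r < s <= t0 -> g s <= g t0) ->
  0 <= derive1 g t0.
Proof.
move=> r0 gd gmax; rewrite leNgt; apply/negP => g'0.
have : \forall h \near (0 : R)^', h^-1 *: (g (h + t0) - g t0) < 0.
  have c : h^-1 *: (g (h + t0) - g t0) @[h --> (0 : R)^'] --> derive1 g t0.
    have E : (fun h => h^-1 *: ((g \o shift t0) (h *: (1 : R)) - g t0))
        = (fun h => h^-1 *: (g (h + t0) - g t0)).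
      by apply/funext => h /=; rewrite [_%:A]mulr1.
    by move: gd; rewrite /derivable E.
  exact: (cvgr_lt _ c).
move=> /nbhs_ballP[e /= e0 He].
pose m := Num.min e r.
have m0 : 0 < m by rewrite lt_min e0 r0.
have me : m <= e by rewrite ge_min lexx.
have mr : m <= r by rewrite ge_min lexx orbT.
have := He (- (m / 2)); rewrite /ball /= sub0r opprK gtr0_norm ?divr_gt0//.
have -> : m / 2 < e by lra.
have n0 : - (m / 2) != 0 by rewrite oppr_eq0 gt_eqF ?divr_gt0.
move=> /(_ isT n0); rewrite /GRing.scale /=.
have : g (- (m / 2) + t0) <= g t0 by apply: gmax; apply/andP; split; lra.
rewrite -subr_le0 => /ler0_norm.
have : (- (m / 2))^-1 < 0 by rewrite invr_lt0; lra.
move=> v0 G; have Gle : g (- (m / 2) + t0) - g t0 <= 0 by rewrite -oppr_ge0 -G normr_ge0.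
by rewrite ltNge mulr_le0// ltW.
Qed.

(** At a positive maximum of [u - W] over [D * [0, T]], which lies in [G] and at
    a positive time, [u] does not decrease in time and the second derivatives of
    [u] along the axes are at most those of [W].  The equation then gives
    [alpha u^p <= (1 + |x|)^m Lap W <= alpha W^p], although [u > W]: strict
    monotonicity of the absorption term replaces the usual perturbation of [W].
    The derivatives of [W] enter as functions [W1], [W2] since [W] is only
    smooth inside [G]. *)
Lemma comparison_principle (m p T : R) (alpha f W : 'rV[R]_d -> R) (u : 'rV[R]_d -> R -> R)
    (W1 W2 : 'I_d -> 'rV[R]_d -> R) (D G : set 'rV[R]_d) :
  0 < p -> (forall x, 0 < alpha x) ->
  nonneg_solution (weighted_laplacian m) (fun=> 0) alpha p f u ->
  compact D -> open G -> G `<=` D -> (forall x, D x -> {for x, continuous W}) ->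
  (forall x, D x -> f x <= W x) ->
  (forall x t, D x -> ~ G x -> 0 <= t <= T -> u x t <= W x) ->
  (forall x, G x -> 0 <= W x) ->
  (forall x i, G x -> is_derive x (delta_mx 0 i) W (W1 i x)) ->
  (forall x i, G x -> is_derive x (delta_mx 0 i) (W1 i) (W2 i x)) ->
  (forall x, G x ->
     (1 + enorm x) `^ m * (\sum_(i < d) W2 i x) <= alpha x * W x `^ p) ->
  forall x t, D x -> 0 <= t <= T -> u x t <= W x.
Proof.
move=> p0 alpha0 [[uc ureg] u0 uf ueq] cD oG GD Wc fW ubd W0 W1E W2E Wsuper x t Dx tT.
pose A : set ('rV[R]_d * R) := D `*` `[0, T]%classic.
have cA : compact A by apply: compact_setX => //; exact: segment_compact.
pose z (q : 'rV[R]_d * R) := u q.1 q.2 - W q.1.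
have [||[x0 t0]] := @compact_EVT_max _ _ z A _ cA.
- by exists (x, t); split.
- rewrite continuous_subspace_in => -[x1 t1] /set_mem [Dx1 /= t1T].
  apply: cvgB.
    have : {within A, continuous (fun q : 'rV[R]_d * R => u q.1 q.2)}.
      apply: continuous_subspaceW uc => -[y s] [_ /=].
      by rewrite in_itv /= => /andP[].
    by apply.
  have : {within A, continuous (fun q : 'rV[R]_d * R => W q.1)}.
    apply: continuous_in_subspaceT => -[y s] /set_mem [/= Dy _].
    by apply: continuous_comp; [exact: cvg_fst|exact: Wc].
  by apply.
rewrite inE => -[/= Dx0]; rewrite in_itv /= => t0T zmax.
have [zle0|zgt0] := leP (z (x0, t0)) 0.
  rewrite -subr_le0; apply: le_trans zle0; apply: (zmax (x, t)).
  by rewrite inE; split.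
have uW : W x0 < u x0 t0 by rewrite -subr_gt0.
exfalso.
have Gx0 : G x0.
  apply: contrapT => nG; have := ubd _ _ Dx0 nG t0T; lra.
have t0_gt0 : 0 < t0.
  case/andP: (t0T); rewrite le_eqVlt => /predU1P[t00|//].
  by have := fW _ Dx0; rewrite -uf t00; lra.
have [[utd _] uxd _ uxxd _] := ureg x0 t0 t0_gt0.
have ut_ge0 : 0 <= derive1 (u x0) t0.
  apply: (@derive1_ge0_at_left_max _ _ t0) => // s; rewrite subrr => /andP[s0 st0].
  have := zmax (x0, s); rewrite inE /z /= => /(_ _).
  have As : A (x0, s).
    by split => //=; rewrite in_itv /= ltW//=; case/andP : t0T => _; exact: le_trans.
  by move=> /(_ As); lra.
have uii (i : 'I_d) : partial i (partial i (u^~ t0)) x0 <= W2 i x0.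
  rewrite -subr_le0.
  have [r r0 Gr] : exists2 r : R, 0 < r & forall s : R, `|s| < r -> G (s *: delta_mx 0 i + x0).
    have : \forall s \near (0 : R), G (s *: delta_mx 0 i + x0).
      have c : {for 0, continuous (fun s : R => s *: (delta_mx 0 i : 'rV[R]_d) + x0)}.
        by apply: cvgD; [apply: cvgZr_tmp; exact: cvg_id|exact: cvg_cst].
      apply: c; rewrite /= scale0r add0r; exact: open_nbhs_nbhs.
    move=> /nbhs_ballP[r /= r0 Hr]; exists r => // s sr.
    by apply: Hr; rewrite /ball /= sub0r normrN.
  pose e : 'rV[R]_d := delta_mx 0 i.
  apply: (@second_derivative_at_max R (fun s => u (s *: e + x0) t0 - W (s *: e + x0))
     (fun s => partial i (u^~ t0) (s *: e + x0) - W1 i (s *: e + x0)) _ r r0).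
  - move=> s sr; apply: is_deriveB.
      apply: (is_derive_line (f := u^~ t0)); apply: derivableP.
      have [_ ux _ _ _] := ureg (s *: e + x0) t0 t0_gt0; exact: ux.
    by apply: (is_derive_line (f := W)); apply: W1E; exact: Gr.
  - apply: is_deriveB.
      apply: (is_derive_line (f := partial i (u^~ t0))).
      by rewrite scale0r add0r; apply: derivableP; exact: uxxd.
    apply: (is_derive_line (f := W1 i)); rewrite scale0r add0r.
    exact: W2E.
  - move=> s sr; rewrite scale0r add0r; apply: (zmax (_, t0)).
    by rewrite inE; split; [apply: GD; exact: Gr|rewrite /= in_itv].
have lapu : laplacian (u^~ t0) x0 <= \sum_(i < d) W2 i x0 by exact: ler_sum.
have Wx0 := W0 _ Gx0.
have := ueq x0 t0 t0_gt0; rewrite mul0r addr0 => E.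
have : (1 + enorm x0) `^ m * laplacian (u^~ t0) x0 <= alpha x0 * W x0 `^ p.
  by apply: le_trans (Wsuper _ Gx0); rewrite ler_wpM2l// powR_ge0.
have : alpha x0 * W x0 `^ p < alpha x0 * u x0 t0 `^ p.
  by rewrite ltr_pM2l// gt0_ltr_powR// nnegrE// u0// ltW.
by move: ut_ge0; rewrite E /weighted_laplacian; lra.
Qed.

End Comparison.

(** * Barriers blowing up on spheres *)

Section LogSublevels.
Context {R : realType} {d : nat}.
Implicit Types (x : 'rV[R]_d).

(** The barriers below are powers of [S - lrho x].  The factor [1 / rho] gained
    by each application of the Laplacian to [lrho] matches the quotient
    [(1 + |x|) ^ (- 2)] of the weights of the absorption and of the diffusion. *)
Definition lrho x : R := ln (rho x).

Lemma lrho_ge0 x : 0 <= lrho x.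
Proof. by rewrite ln_ge0// rho_ge1. Qed.

Lemma continuous_lrho : continuous lrho.
Proof.
by move=> x; apply: continuous_comp; [exact: continuous_rho|exact: continuous_ln (rho_gt0 x)].
Qed.

Lemma norm_le_enorm x : `|x| <= enorm x.
Proof.
rewrite [leLHS]mx_normrE; apply: bigmax_le; first exact: enorm_ge0.
by move=> [i j] _ /=; rewrite ord1; exact: coord_le_enorm.
Qed.

Lemma lrho_le_norm x (M : R) : `|x| <= M -> lrho x <= ln (1 + d%:R * M ^+ 2).
Proof.
move=> xM; have M0 : 0 <= M by apply: le_trans xM.
rewrite ler_ln ?posrE ?rho_gt0//; last first.
  by rewrite ltr_wpDr// mulr_ge0// sqr_ge0.
rewrite lerD2l enorm_sqr -[d%:R]mulr1 -[d in leRHS](card_ord d) mulrAC mulr1 mulr_natl -sumr_const.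
apply: ler_sum => i _; rewrite -[leLHS]real_normK ?num_real//.
rewrite ler_pXn2r ?nnegrE//; apply: le_trans xM.
rewrite [leRHS]mx_normrE; exact: (le_bigmax _ (fun ij => `|x ij.1 ij.2|) (0, i)).
Qed.

Lemma compact_lrho_le (a : R) : compact [set x | lrho x <= a].
Proof.
apply: bounded_closed_compact.
  exists (expR a); split; first exact: num_real.
  move=> M aM x /= xa; apply: le_trans (norm_le_enorm x) _.
  apply: le_trans (ltW aM); rewrite -ler_expR lnK ?posrE ?rho_gt0// in xa.
  by apply: le_trans xa; exact: enorm_le_rho.
rewrite (_ : [set x | _] = lrho @^-1` [set y | y <= a])//.
by apply: closed_comp => [x _|]; [exact: continuous_lrho | exact: closed_le].
Qed.

Lemma open_lrho_lt (a : R) : open [set x | lrho x < a].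
Proof.
rewrite (_ : [set x | _] = lrho @^-1` [set y | y < a])//.
by apply: open_comp => [x _|]; [exact: continuous_lrho | exact: open_lt].
Qed.

Lemma open_lrho_gt (a : R) : open [set x | a < lrho x].
Proof.
rewrite (_ : [set x | _] = lrho @^-1` [set y | a < y])//.
by apply: open_comp => [x _|]; [exact: continuous_lrho | exact: open_gt].
Qed.

End LogSublevels.

Section Barrier.
Context {R : realType} {d : nat}.
Variables (p c : R).
Hypotheses (p1 : 1 < p) (c0 : 0 < c).
Implicit Types (x : 'rV[R]_d) (S : R).

(* the exponent for which [h ^ (- q - 2) = (h ^ (- q)) ^ p] *)
Let q : R := 2 * (p - 1)^-1.

Let q_gt0 : 0 < q. Proof. by rewrite mulr_gt0// invr_gt0 subr_gt0. Qed.

(** [barrier_coef S ^ (p - 1) = barrier_const S], and this affine function of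
    [S] is what turns the bound on the Laplacian of [(S - lrho x) ^ (- q)] into
    the supersolution inequality. *)
Definition barrier_const S : R := 2 * q * (2 * d%:R * S + 4 * (q + 1)) / c.

Definition barrier_coef S : R := barrier_const S `^ (p - 1)^-1.

Definition barrier S x : R := barrier_coef S * (S - lrho x) `^ (- q).

Lemma barrier_const_gt0 S : 0 < S -> 0 < barrier_const S.
Proof.
move=> S0; have q0 := q_gt0; apply: divr_gt0 => //; apply: mulr_gt0; first lra.
have : 0 <= 2 * d%:R * S by rewrite !mulr_ge0// ltW.
lra.
Qed.

Lemma barrier_coef_gt0 S : 0 < S -> 0 < barrier_coef S.
Proof. by move=> S0; rewrite powR_gt0// barrier_const_gt0. Qed.

Lemma barrier_coefX S : 0 < S -> barrier_coef S `^ (p - 1) = barrier_const S.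
Proof.
move=> S0; rewrite -powRrM mulVf ?powRr1//; last by rewrite gt_eqF// subr_gt0.
by rewrite ltW// barrier_const_gt0.
Qed.

(** The form from which the decay in [S] is read off: the numerator is affine
    and the denominator quadratic in [S]. *)
Lemma barrierE S x : 0 < S -> lrho x < S ->
  barrier S x = (barrier_const S / (S - lrho x) ^+ 2) `^ (p - 1)^-1.
Proof.
move=> S0 xS; have h0 : 0 < S - lrho x by rewrite subr_gt0.
rewrite powRM ?invr_ge0 ?sqr_ge0//; last by rewrite ltW// barrier_const_gt0.
congr (_ * _); rewrite -powR_mulrn ?(ltW h0)// -powRN -powRrM; congr (_ `^ _).
by rewrite /q mulNr.
Qed.

Let is_derive_gap_powR S (a z : R) : 0 < z -> ln z < S ->
  is_derive z 1 (fun z => (S - ln z) `^ a) (a * (S - ln z) `^ (a - 1) * - z^-1).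
Proof.
move=> z0 zS.
have D : is_derive z 1 (fun z => S - ln z) (- z^-1).
  have L := is_derive1_ln z0.
  by apply: is_derive_eq; rewrite add0r mul1r.
apply: (is_derive_comp_dir (f := fun z => S - ln z) (H := fun y => y `^ a)) => //.
  by apply/derivable1_diffP; case: D.
by apply: is_derive1_powR; rewrite subr_gt0.
Qed.

(* the first two derivatives in [z] of the barrier as a function of [z = rho x] *)
Let profile1 S (z : R) := barrier_coef S * q * (S - ln z) `^ (- q - 1) * z^-1.
Let profile2 S (z : R) := barrier_coef S * q *
  ((q + 1) * (S - ln z) `^ (- q - 2) - (S - ln z) `^ (- q - 1)) * z^-1 ^+ 2.

Let is_derive_profile S (z : R) : 0 < z -> ln z < S ->
  is_derive z 1 (fun z => barrier_coef S * (S - ln z) `^ (- q)) (profile1 S z).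
Proof.
move=> z0 zS; have D := is_derive_gap_powR (- q) z0 zS.
have := is_deriveZ (barrier_coef S) D.
by rewrite /GRing.scale /= /profile1 => /is_derive_eq; apply; ring.
Qed.

Let is_derive_profile1 S (z : R) : 0 < z -> ln z < S ->
  is_derive z 1 (profile1 S) (profile2 S z).
Proof.
move=> z0 zS; have D := is_derive_gap_powR (- q - 1) z0 zS.
have zn0 : z != 0 by rewrite gt_eqF.
have V : is_derive z 1 (fun z : R => z^-1) (- z ^- 2).
  have VD := derivableV zn0 (@derivable_id _ _ z 1).
  split; first exact: VD.
  by rewrite (deriveV zn0 (@derivable_id _ _ z 1)) derive_id /GRing.scale /= mulr1.
have -> : profile1 S = (barrier_coef S * q) *:
    ((fun z => (S - ln z) `^ (- q - 1)) * (fun z => z^-1)).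
  by apply/funext => y; rewrite /profile1 -mulrA.
apply: is_derive_eq; rewrite /profile2 /GRing.scale /=.
by rewrite -[- q - 2]/(- q - (1 + 1)) opprD addrA -exprVn; ring.
Qed.

(** With [h = S - lrho x], the Laplacian of [h ^ (- q)] is at most
    [q h ^ (- q - 2) (2 d h + 4 (q + 1)) / rho], and [0 <= h <= S]; this is the
    supersolution inequality.  Near the sphere [lrho x = S] the barrier exceeds
    any bound of [u] on the compact ball, so the comparison is made on the ball
    [lrho x <= S - e] for a small [e]. *)
Lemma solution_le_barrier (m S : R) (alpha f : 'rV[R]_d -> R)
    (u : 'rV[R]_d -> R -> R) :
  0 < S -> (forall x, 0 < alpha x) ->
  (forall x, c * (1 + enorm x) `^ (m - 2) <= alpha x) ->
  nonneg_solution (weighted_laplacian m) (fun=> 0) alpha p f u ->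
  (forall x, lrho x < S -> f x <= barrier S x) ->
  forall x (t : R), lrho x < S -> 0 <= t -> u x t <= barrier S x.
Proof.
move=> S0 alpha0 alpha_ge usol fle x t xS t0.
have K0 := barrier_coef_gt0 S0.
have [[uc _] _ _ _] := usol.
have [M M0 uM] : exists2 M : R, 0 < M &
    forall y s, lrho y <= S -> 0 <= s <= t -> u y s <= M.
  have cA : compact ([set y : 'rV[R]_d | lrho y <= S] `*` `[0, t]%classic).
    by apply: compact_setX; [exact: compact_lrho_le|exact: segment_compact].
  have [||[y0 s0] _ H] := @compact_EVT_max _ _ (fun z => u z.1 z.2) _ _ cA.
  - by exists (x, t); split => /=; [exact: ltW|rewrite in_itv /= t0 lexx].
  - by apply: continuous_subspaceW uc => -[y s] [_ /=]; rewrite in_itv /= => /andP[].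
  exists (Num.max (u y0 s0) 1); first by rewrite lt_max ltr01 orbT.
  move=> y s yS st; rewrite le_max; apply/orP; left; apply: (H (y, s)).
  by rewrite inE; split => //=; rewrite in_itv.
(* [(M / barrier_coef S) ^ (- 1 / q)] is the gap at which the barrier equals [M] *)
pose e := Num.min ((M / barrier_coef S) `^ (- q^-1)) (S - lrho x).
have MK : 0 < M / barrier_coef S by rewrite divr_gt0.
have e0 : 0 < e by rewrite lt_min powR_gt0//= subr_gt0.
have eM : M <= barrier_coef S * e `^ (- q).
  rewrite -ler_pdivrMl// mulrC.
  have -> : M / barrier_coef S = ((M / barrier_coef S) `^ (- q^-1)) `^ (- q).
    by rewrite -powRrM mulrNN mulVf ?gt_eqF// powRr1// ltW.
  rewrite !(powRN _ q) lef_pV2 ?posrE ?powR_gt0//.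
  rewrite ge0_ler_powR// ?nnegrE ?(ltW e0) ?powR_ge0 ?(ltW q_gt0)//.
  by rewrite ge_min lexx.
have xe : lrho x <= S - e.
  have : e <= S - lrho x by rewrite ge_min lexx orbT.
  lra.
apply: (@comparison_principle R d m p t alpha f (barrier S) u
   (fun i y => 2 * y 0 i * profile1 S (rho y))
   (fun i y => 2 * (i == i)%:R * profile1 S (rho y)
       + 4 * y 0 i * y 0 i * profile2 S (rho y))
   [set y | lrho y <= S - e] [set y | lrho y < S - e]) => //.
- by apply: lt_trans p1.
- exact: compact_lrho_le.
- exact: open_lrho_lt.
- by move=> y /= /ltW.
- move=> y /= yS.
  apply: (@continuous_comp _ _ _ rho
     (fun z => barrier_coef S * (S - ln z) `^ (- q))); first exact: continuous_rho.
  have yS' : ln (rho y) < S by rewrite -/(lrho y); lra.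
  have [D _] := is_derive_profile (rho_gt0 y) yS'.
  by apply: differentiable_continuous; exact/derivable1_diffP.
- by move=> y /= yS; apply: fle; lra.
- move=> y s /= yS /negP; rewrite -leNgt => yS' st.
  have -> : barrier S y = barrier_coef S * e `^ (- q).
    by rewrite /barrier; congr (_ * _ `^ _); lra.
  by apply: le_trans eM; apply: uM => //; lra.
- by move=> y _; rewrite mulr_ge0 ?powR_ge0.
- move=> y i /= yS; apply: (is_derive_radial (H := fun z => barrier_coef S * (S - ln z) `^ (- q))).
  by apply: is_derive_profile; [exact: rho_gt0|rewrite -/(lrho y); lra].
- move=> y i /= yS; apply: is_derive_radial2.
  by apply: is_derive_profile1; [exact: rho_gt0|rewrite -/(lrho y); lra].
- move=> y /= yS.
  have -> : \sum_(i < d) (2 * (i == i)%:R * profile1 S (rho y) +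
      4 * y 0 i * y 0 i * profile2 S (rho y))
    = d%:R * (2 * profile1 S (rho y)) + 4 * (rho y - 1) * profile2 S (rho y).
    rewrite -radial_laplacian_sum; apply: eq_bigr => i _.
    by rewrite eqxx mulr1 expr2 !mulrA.
  pose h := S - lrho y.
  have h0 : 0 < h by rewrite /h; lra.
  have hS : h <= S by rewrite /h; have := lrho_ge0 y; lra.
  have z1 := rho_ge1 y; have z0 := rho_gt0 y.
  pose z := rho y; pose K := barrier_coef S.
  have K_ge0 : 0 <= K by exact: ltW.
  have zV_ge0 : 0 <= z^-1 by rewrite invr_ge0 ltW.
  have q_ge0 := ltW q_gt0.
  pose Q := h `^ (- q - 2).
  have Q0 : 0 <= Q by rewrite powR_ge0.
  have Qh : h `^ (- q - 1) = h * Q.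
    rewrite /Q -[X in _ = X * _](powRr1 (ltW h0)) -powRD; last by rewrite (gt_eqF h0) implybT.
    by congr (_ `^ _); lra.
  have -> : profile1 S (rho y) = K * q * (h * Q) * z^-1 by rewrite -Qh.
  have -> : profile2 S (rho y) = K * q * ((q + 1) * Q - h * Q) * z^-1 ^+ 2.
    by rewrite -Qh.
  pose b := 2 * d%:R * S + 4 * (q + 1).
  have lapW : d%:R * (2 * (K * q * (h * Q) * z^-1)) +
     4 * (rho y - 1) * (K * q * ((q + 1) * Q - h * Q) * z^-1 ^+ 2)
     <= K * q * Q * z^-1 * b.
    have -> : d%:R * (2 * (K * q * (h * Q) * z^-1)) +
     4 * (rho y - 1) * (K * q * ((q + 1) * Q - h * Q) * z^-1 ^+ 2) =
     K * q * Q * z^-1 * (2 * d%:R * h + 4 * (1 - z^-1) * (q + 1 - h)).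
      by rewrite -/z; field; rewrite /z gt_eqF.
    have KqQz : 0 <= K * q * Q * z^-1 by do 3 (apply: mulr_ge0 => //).
    apply: ler_wpM2l => //.
    rewrite /b lerD//; first by apply: ler_wpM2l => //; rewrite mulr_ge0 ?ler0n.
    have zi1 : z^-1 <= 1 by rewrite invf_le1.
    have := q_gt0; nra.
  have e1 : 0 < 1 + enorm y by rewrite ltr_pwDl// enorm_ge0.
  have -> : (1 + enorm y) `^ m = (1 + enorm y) `^ (m - 2) * (1 + enorm y) ^+ 2.
    rewrite -powR_mulrn ?ltW// -powRD ?subrK// (gt_eqF e1) implybT//.
  have w0 : 0 < (1 + enorm y) `^ (m - 2) by rewrite powR_gt0.
  have Wp : barrier S y `^ p = K * barrier_const S * Q.
    rewrite /barrier powRM ?powR_ge0 ?(ltW K0)//; congr (_ * _).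
      rewrite -{1}(subrK 1 p) addrC powRD; last by rewrite (gt_eqF K0) implybT.
      by rewrite powRr1 ?(ltW K0)// barrier_coefX.
    rewrite -powRrM; congr (_ `^ _); rewrite /q; field.
    by rewrite gt_eqF// subr_gt0.
  rewrite Wp; apply: (@le_trans _ _ (c * (1 + enorm y) `^ (m - 2) * (K * barrier_const S * Q))); last first.
    apply: ler_wpM2r; last exact: alpha_ge.
    by apply: mulr_ge0 => //; apply: mulr_ge0 => //; rewrite ltW// barrier_const_gt0.
  have -> : c * (1 + enorm y) `^ (m - 2) * (K * barrier_const S * Q)
     = (1 + enorm y) `^ (m - 2) * ((2 * z) * (K * q * Q * z^-1 * b)).
    rewrite /barrier_const -/b; field.
    by rewrite /z !gt_eqF.
  rewrite -mulrA ler_pM2l//; apply: (@le_trans _ _ ((1 + enorm y) ^+ 2 * (K * q * Q * z^-1 * b))).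
    by rewrite ler_wpM2l// sqr_ge0.
  apply: ler_wpM2r; last exact: sqr_le_rho.
  apply: mulr_ge0; first by do 3 (apply: mulr_ge0 => //).
  apply: addr_ge0; last by rewrite mulr_ge0// addr_ge0.
  by rewrite !mulr_ge0// ltW.
- by rewrite t0 lexx.
Qed.

(** For [S >= 2 S0 + 1] the gap [S - lrho x] is at least [S / 2], so the barrier
    is at most [(4 barrier_const S / S^2) ^ (1 / (p - 1))]. *)
Lemma barrier_vanishes (S0 e : R) : 0 <= S0 -> 0 < e ->
  \forall S \near +oo, forall x, lrho x <= S0 -> barrier S x <= e.
Proof.
move=> S00 e0; pose a : R := 2 * q * (2 * d%:R) / c.
pose b : R := 2 * q * (4 * (q + 1)) / c.
have q0 := q_gt0.
have a0 : 0 <= a by apply: divr_ge0 (ltW c0); apply: mulr_ge0; [lra|rewrite mulr_ge0 ?ler0n].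
have b0 : 0 <= b by apply: divr_ge0 (ltW c0); apply: mulr_ge0; lra.
have e1 : 0 < e `^ (p - 1) by rewrite powR_gt0.
near=> S => x xS0.
have S1 : 1 <= S by near: S; exact: nbhs_pinfty_ge.
have SS0 : 2 * S0 + 1 <= S by near: S; apply: nbhs_pinfty_ge; exact: num_real.
have Se : 4 * (a + b) / e `^ (p - 1) <= S.
  by near: S; apply: nbhs_pinfty_ge; exact: num_real.
have Spos : 0 < S by lra.
have xS : lrho x < S by lra.
rewrite barrierE//.
have -> : e = (e `^ (p - 1)) `^ (p - 1)^-1.
  by rewrite -powRrM mulfV ?powRr1 ?(ltW e0)// gt_eqF// subr_gt0.
have h0 : 0 < S - lrho x by lra.
apply: ge0_ler_powR.
- by rewrite invr_ge0 subr_ge0 ltW.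
- by rewrite nnegrE divr_ge0 ?sqr_ge0// ltW// barrier_const_gt0.
- by rewrite nnegrE powR_ge0.
rewrite ler_pdivrMr ?exprn_gt0//.
have -> : barrier_const S = a * S + b.
  by rewrite /barrier_const /a /b; field; rewrite gt_eqF.
rewrite ler_pdivrMr// in Se.
have hS : S / 2 <= S - lrho x by lra.
apply: (@le_trans _ _ (e `^ (p - 1) * (S / 2) ^+ 2)); last first.
  by rewrite ler_wpM2l ?(ltW e1)// ler_pXn2r ?nnegrE//; lra.
have E : e `^ (p - 1) * (S / 2) ^+ 2 = S * e `^ (p - 1) * S / 4 by field.
have : 4 * (a + b) * S <= S * e `^ (p - 1) * S by rewrite ler_wpM2r// ltW.
rewrite E; nra.
Unshelve. all: by end_near. Qed.

(** The value [+oo] off the ball makes the integral of the barrier infinite for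
    every measure that charges the outside. *)
Definition ebarrier S x : \bar R :=
  if lrho x < S then (barrier S x)%:E else +oo%E.

(** Bounding the gap from below by [1 / (k + 1)] removes the singularity, and
    the last factor cuts the support off at [lrho x = k + 1].  Both operations
    are monotone in [k], which makes these admissible test functions increase
    to [ebarrier S]. *)
Definition barrier_approx S (k : nat) x : R :=
  barrier_coef S * Num.max (S - lrho x) k.+1%:R^-1 `^ (- q) *
  Num.max 0 (1 - lrho x / k.+1%:R).

Lemma barrier_approx_ge0 S k x : 0 <= barrier_approx S k x.
Proof. by rewrite !mulr_ge0 ?powR_ge0// le_max lexx. Qed.

Let ler_powRN (y z : R) : 0 < y -> y <= z -> z `^ (- q) <= y `^ (- q).
Proof.
move=> y0 yz; have z0 := lt_le_trans y0 yz.
rewrite !powRN lef_pV2 ?posrE ?powR_gt0// ge0_ler_powR ?nnegrE ?(ltW y0) ?(ltW z0)//.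
exact: ltW.
Qed.

Lemma barrier_approx_nd S x : {homo barrier_approx S ^~ x : k l / (k <= l)%N >-> k <= l}.
Proof.
move=> k l kl; have kl' : l.+1%:R^-1 <= k.+1%:R^-1 :> R.
  by rewrite lef_pV2 ?posrE ?ltr0Sn// ler_nat ltnS.
apply: ler_pM.
- by rewrite mulr_ge0 ?powR_ge0.
- by rewrite le_max lexx.
- apply: ler_wpM2l; first exact: powR_ge0.
  apply: ler_powRN; first by rewrite lt_max invr_gt0 ltr0Sn orbT.
  by rewrite ge_max !le_max lexx kl' !orbT.
- rewrite ge_max !le_max lexx/=; apply/orP; right.
  by rewrite lerD2l lerN2 ler_wpM2l// lrho_ge0.
Qed.

Lemma barrier_approx_le S k x : lrho x < S -> barrier_approx S k x <= barrier S x.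
Proof.
move=> xS; rewrite -[leRHS]mulr1; apply: ler_pM.
- by rewrite mulr_ge0 ?powR_ge0.
- by rewrite le_max lexx.
- apply: ler_wpM2l; first exact: powR_ge0.
  by apply: ler_powRN; [rewrite subr_gt0|rewrite le_max lexx].
- by rewrite ge_max ler01/= gerBl divr_ge0// lrho_ge0.
Qed.

Lemma continuous_barrier_approx S k : continuous (barrier_approx S k).
Proof.
move=> x; pose g (y : 'rV[R]_d) := Num.max (S - lrho y) k.+1%:R^-1.
have gc : {for x, continuous g}.
  apply: (@continuous_max R _ (fun y => S - lrho y) (cst _)); last exact: cst_continuous.
  exact: (@cvgB _ _ _ _ _ (cst S) lrho _ _ (cvg_cst _) (@continuous_lrho _ _ x)).
have hc : {for x, continuous (fun y : 'rV[R]_d => 1 - lrho y / k.+1%:R)}.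
  apply: (@continuous_comp _ _ _ lrho (fun z : R => 1 - z / k.+1%:R)).
    exact: continuous_lrho.
  by apply: cvgB; [exact: cvg_cst|apply: cvgMr_tmp; exact: cvg_id].
have c2 : {for x, continuous (fun y : 'rV[R]_d => Num.max 0 (1 - lrho y / k.+1%:R))}.
  by apply: (@continuous_max R _ (cst 0) (fun y => 1 - lrho y / k.+1%:R)); [exact: cst_continuous|exact: hc].
have c1 : {for x, continuous (fun y => barrier_coef S * g y `^ (- q))}.
  apply: (@continuous_comp _ _ _ g (fun z => barrier_coef S * z `^ (- q))) => //.
  have g0 : 0 < g x by rewrite lt_max invr_gt0 ltr0Sn orbT.
  have [D _] := is_derive1_powR (- q) g0.
  have pc : {for g x, continuous (fun z : R => z `^ (- q))}.
    by apply: differentiable_continuous; exact/derivable1_diffP.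
  exact: (@cvgMl_tmp _ _ (nbhs (g x)) _ _ _ _ pc).
exact: (cvgM c1 c2).
Qed.

Lemma Ccp_barrier_approx S k : Ccp (barrier_approx S k).
Proof.
split; [exact: continuous_barrier_approx|exact: barrier_approx_ge0|].
apply: (@subclosed_compact _ _ [set x : 'rV[R]_d| lrho x <= k.+1%:R]).
- exact: closed_closure.
- exact: compact_lrho_le.
rewrite [X in _ `<=` X](closure_id _).1; last first.
  by apply: compact_closed; [exact: norm_hausdorff|exact: compact_lrho_le].
apply: closure_subset => x /=; apply: contraNle => xk.
rewrite /barrier_approx [X in _ * X]max_l ?mulr0//.
by rewrite subr_le0 ler_pdivlMr ?ltr0Sn// mul1r ltW.
Qed.

Lemma cvg_barrier_approx S x : 0 < S ->
  (barrier_approx S k x)%:E @[k --> \oo] --> ebarrier S x.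
Proof.
move=> S0; rewrite /ebarrier; case: ltP => xS.
  apply: cvg_EFin; first by near=> k.
  have c1 : (barrier S x * (1 - lrho x * k.+1%:R^-1)) @[k --> \oo] --> barrier S x.
    rewrite -[X in _ --> X]mulr1 -[X in _ * X]subr0 -[X in _ - X](mulr0 (lrho x)).
    apply: cvgMl_tmp; apply: cvgB; first exact: cvg_cst.
    by apply: cvgMl_tmp; exact: cvg_harmonic.
  apply: cvg_trans c1; apply: near_eq_cvg; near=> k.
  have k1 : (S - lrho x)^-1 <= k.+1%:R.
    apply: (@le_trans _ _ k%:R); last by rewrite ler_nat.
    by near: k; exact: nbhs_infty_ger.
  have k2 : lrho x <= k.+1%:R.
    apply: (@le_trans _ _ k%:R); last by rewrite ler_nat.
    by near: k; exact: nbhs_infty_ger.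
  rewrite /barrier_approx /= max_l; last first.
    by rewrite invf_ple ?posrE ?subr_gt0 ?ltr0Sn.
  by rewrite max_r// subr_ge0 ler_pdivrMr ?ltr0Sn// mul1r.
have K0 := barrier_coef_gt0 S0.
apply/cvgeryP/cvgryPge => A; near=> k.
have k2 : 2 * lrho x <= k.+1%:R.
  apply: (@le_trans _ _ k%:R); last by rewrite ler_nat.
  by near: k; exact: nbhs_infty_ger.
have k3 : (2 * Num.max A 0 / barrier_coef S) `^ q^-1 <= k.+1%:R.
  apply: (@le_trans _ _ k%:R); last by rewrite ler_nat.
  by near: k; exact: nbhs_infty_ger.
rewrite /barrier_approx max_r; last first.
  by apply: (@le_trans _ _ 0); [rewrite subr_le0|rewrite invr_ge0].
have -> : k.+1%:R^-1 `^ (- q) = k.+1%:R `^ q.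
  by rewrite -powR_inv1 ?ler0n// -powRrM mulN1r opprK.
have : 2 * Num.max A 0 / barrier_coef S <= k.+1%:R `^ q.
  apply: le_trans (_ : _ <= ((2 * Num.max A 0 / barrier_coef S) `^ q^-1) `^ q) _.
    rewrite -powRrM mulVf ?gt_eqF// powRr1//.
    by rewrite divr_ge0 ?(ltW K0)// mulr_ge0// le_max lexx orbT.
  by apply: ge0_ler_powR => //; rewrite ?nnegrE ?powR_ge0// ltW.
rewrite ler_pdivrMr// => k4.
have half : 2^-1 <= Num.max 0 (1 - lrho x / k.+1%:R).
  rewrite le_max; apply/orP; right.
  have : lrho x / k.+1%:R <= 2^-1.
    by rewrite ler_pdivrMr ?ltr0Sn// mulrC ler_pdivlMr// mulrC.
  by move: (lrho x / _) => t; lra.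
have A1 : A <= Num.max A 0 by rewrite le_max lexx.
have A2 : 0 <= Num.max A 0 by rewrite le_max lexx orbT.
nra.
Unshelve. all: by end_near. Qed.

Lemma ebarrier_ge0 S x : (0 <= ebarrier S x)%E.
Proof. by rewrite /ebarrier; case: ifP => _; rewrite ?lee_fin ?mulr_ge0 ?powR_ge0. Qed.

End Barrier.

(** * Integration of functionals of the process *)

(** The Markov property is given for events [Z @^-1` G] only; the usual passage
    through simple functions extends it to nonnegative measurable functions.
    [k w] lives on the sample space and is only known to depend measurably on
    [w] for events determined by [Y], which is why the statement is about [Y]
    and [k] rather than about a kernel. *)
Section Disintegration.
Context {R : realType} {d1 d2 : measure_display}.
Context {Omega : measurableType d1} {T : measurableType d2}.
Variables (P : {measure set Omega -> \bar R}) (k : Omega -> {measure set Omega -> \bar R}).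
Variables (A : set Omega) (Y Z : Omega -> T).
Hypotheses (mA : measurable A) (mY : measurable_fun setT Y) (mZ : measurable_fun setT Z).
Hypothesis mk : forall G, measurable G -> measurable_fun A (fun w => k w (Y @^-1` G)).
Hypothesis PE : forall G, measurable G ->
  P (A `&` Z @^-1` G) = (\int[P]_(w in A) k w (Y @^-1` G))%E.

Local Open Scope ereal_scope.
Import HBNNSimple.

Let mpre (W : Omega -> T) G : measurable_fun setT W -> measurable G -> measurable (W @^-1` G).
Proof. by move=> mW mG; rewrite -[_ @^-1` _]setTI; exact: mW. Qed.

Let integral_nnsfunE (m : {measure set Omega -> \bar R}) (D : set Omega)
    (W : Omega -> T) (h : {nnsfun T >-> R}) :
  measurable D -> measurable_fun setT W ->
  \int[m]_(w in D) (h (W w))%:E =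
    \sum_(r \in range h) r%:E * m (W @^-1` (h @^-1` [set r]) `&` D).
Proof.
move=> mD mW; under eq_integral do rewrite fimfunE -fsumEFin//.
rewrite ge0_integral_fsum//; last 2 first.
- move=> r; apply/measurable_EFinP; apply: measurable_funS measurableT _ _ => //.
  apply: measurable_funM => //.
  by apply: (@measurableT_comp _ _ _ _ _ _ (\1_(h @^-1` [set r]) : T -> R)).
- by move=> r w _; rewrite EFinM nnfun_muleindic_ge0.
apply: eq_fsbigr => r; rewrite inE => -[x _ <-].
under eq_integral do rewrite EFinM.
rewrite ge0_integralZl//.
- congr (_ * _).
  by rewrite -(integral_indic _ mD (mpre mW (measurable_sfunP h (measurable_set1 (h x))))).
- apply/measurable_EFinP; apply: measurable_funS measurableT _ _ => //.
  by apply: (@measurableT_comp _ _ _ _ _ _ (\1_(h @^-1` [set h x]) : T -> R)).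
- by rewrite lee_fin.
Qed.

Let disintegration_nnsfun (h : {nnsfun T >-> R}) :
  \int[P]_(w in A) (h (Z w))%:E = \int[P]_(w in A) \int[k w]_w' (h (Y w'))%:E.
Proof.
rewrite integral_nnsfunE//.
under [RHS]eq_integral do rewrite integral_nnsfunE//.
have mh r : measurable (h @^-1` [set r]) by exact: measurable_sfunP.
rewrite ge0_integral_fsum//; last 2 first.
- by move=> r; apply: measurable_funeM; under eq_fun do rewrite setIT; exact: (mk (mh r)).
- move=> r w _; have [r0|r0] := leP 0%R r; first by rewrite mule_ge0.
  by rewrite preimage_nnfun0// preimage_set0 set0I measure0 mule0.
apply: eq_fsbigr => r; rewrite inE => -[x _ <-].
under [RHS]eq_integral do rewrite setIT.
rewrite ge0_integralZl// ?lee_fin//; last exact: (mk (mh (h x))).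
by rewrite setIC PE.
Qed.

Let measurable_int_nnsfun (h : {nnsfun T >-> R}) :
  measurable_fun A (fun w => \int[k w]_w' (h (Y w'))%:E).
Proof.
under eq_fun do rewrite integral_nnsfunE//.
apply: emeasurable_fsum => // r; apply: measurable_funeM.
by under eq_fun do rewrite setIT; apply: mk; exact: measurable_sfunP.
Qed.

Section Approximation.
Variable h : T -> \bar R.
Hypotheses (h0 : forall x, 0 <= h x) (mh : measurable_fun setT h).

Let h_ := nnsfun_approx measurableT mh.

Let nd x : nondecreasing_seq (fun n => (h_ n x)%:E).
Proof. by move=> a b ab; rewrite lee_fin; exact/lefP/nd_nnsfun_approx. Qed.

Let mhW n (W : Omega -> T) D : measurable D -> measurable_fun setT W ->
  measurable_fun D (fun w => (h_ n (W w))%:E).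
Proof.
move=> mD mW; apply/measurable_EFinP; apply: measurable_funS measurableT _ _ => //.
exact: measurableT_comp.
Qed.

Let integral_cvg (m : {measure set Omega -> \bar R}) D W : measurable D ->
  measurable_fun setT W ->
  \int[m]_(w in D) (h_ n (W w))%:E @[n --> \oo] --> \int[m]_(w in D) h (W w).
Proof.
move=> mD mW.
have -> : \int[m]_(w in D) h (W w) = \int[m]_(w in D) limn (fun n => (h_ n (W w))%:E).
  by apply: eq_integral => w _; apply/esym/cvg_lim => //; exact: cvg_nnsfun_approx.
apply: cvg_monotone_convergence => //.
- by move=> n; exact: mhW.
- by move=> n w _; rewrite lee_fin.
Qed.

Lemma measurable_integral_disintegration :
  measurable_fun A (fun w => \int[k w]_w' h (Y w')).
Proof.
apply: (emeasurable_fun_cvg (fun n w => \int[k w]_w' (h_ n (Y w'))%:E)).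
  by move=> n; exact: measurable_int_nnsfun.
by move=> w _; exact: integral_cvg.
Qed.

Lemma ge0_integral_disintegration :
  \int[P]_(w in A) h (Z w) = \int[P]_(w in A) \int[k w]_w' h (Y w').
Proof.
have L := @integral_cvg P A Z mA mZ.
rewrite -(cvg_lim _ L)//; apply/cvg_lim => //.
under eq_fun do rewrite disintegration_nnsfun.
have -> : \int[P]_(w in A) \int[k w]_w' h (Y w') =
    \int[P]_(w in A) limn (fun n => \int[k w]_w' (h_ n (Y w'))%:E).
  by apply: eq_integral => w _; apply/esym/cvg_lim => //; exact: integral_cvg.
apply: cvg_monotone_convergence => //.
- by move=> n w _; apply: integral_ge0 => w' _; rewrite lee_fin.
- move=> w _ a b ab; apply: ge0_le_integral => //.
  + by move=> w' _; rewrite lee_fin.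
  + exact: mhW.
  + exact: mhW.
  + by move=> w' _; exact: nd.
Qed.

End Approximation.

End Disintegration.

Section FiniteMeasureSpace.
Context {R : realType} {d : nat}.
Local Notation V := 'rV[R]_d.
Local Notation MF := (finite_measures R d).
Local Open Scope ereal_scope.

Lemma measurable_MF_eval (B : set (borel V)) : measurable B ->
  measurable_fun [set: MF] (fun nu : MF => nu B).
Proof.
move=> mB.
apply: (@measurability (MF_display : measure_display) _ MF _ setT (fun nu : MF => nu B) measurable).
  by rewrite smallest_id//; exact: sigma_algebra_measurable.
apply: subset_trans; last exact: sub_gen_smallest.
exact: (bigcup_sup mB).
Qed.

Lemma measurable_MF_integral (f : borel V -> \bar R) :
  measurable_fun setT f -> (forall x, 0 <= f x) ->
  measurable_fun [set: MF] (fun nu : MF => \int[nu]_x f x).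
Proof.
move=> mf f0.
apply: (@measurable_fun_integral_kernel _ _ MF (borel V) R
  (fun nu : MF => nu : {measure set (borel V) -> \bar R})) => // U mU.
exact: measurable_MF_eval.
Qed.

Lemma borel_open (T : ptopologicalType) (U : set T) : open U -> measurable (U : set (borel T)).
Proof. by move=> oU; exact: sub_gen_smallest. Qed.

Lemma borel_closed (T : ptopologicalType) (U : set T) : closed U -> measurable (U : set (borel T)).
Proof.
move=> cU; rewrite -[U]setCK; apply: (@measurableC _ (borel T)); apply: borel_open.
exact: closed_openC.
Qed.

Lemma continuous_borel_measurable (T : ptopologicalType) (f : T -> R) :
  continuous f -> measurable_fun setT (f : borel T -> R).
Proof.
move=> /continuousP cf; apply: (measurability _ (RGenOpens.measurableE R)).
move=> _ [_ [a [b ->] <-]]; rewrite setTI; apply: borel_open.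
exact/cf/interval_open.
Qed.

End FiniteMeasureSpace.

Section ExtendedExponential.
Context {R : realType}.
Local Open Scope ereal_scope.

Lemma measurable_expeR : measurable_fun setT (@expeR R).
Proof.
apply: (measurability _ (ErealGenOInfty.measurableE R)).
move=> _ [_ [r ->] <-]; rewrite setTI.
have [r0|r0] := ltP r 0%R.
  rewrite (_ : _ @^-1` _ = setT)//; apply/seteqP; split => // x _ /=.
  by rewrite in_itv/= andbT (lt_le_trans _ (expeR_ge0 x))// lte_fin.
rewrite (_ : _ @^-1` _ = [set` `]lne r%:E, +oo[]); first exact: emeasurable_itv.
apply/seteqP; split => x /=; rewrite !in_itv/= !andbT -(lte_expeR (lne r%:E) x) lneK//.
- by rewrite in_itv/= lee_fin r0 leey.
- by rewrite in_itv/= lee_fin r0 leey.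
Qed.

Lemma cvg_expeR (u : (\bar R)^nat) (l : \bar R) :
  l < +oo -> u @ \oo --> l -> expeR (u n) @[n --> \oo] --> expeR l.
Proof.
case: l => [r|//|] _ ul /=.
- move/fine_cvgP : ul => [ufin ur]; apply: cvg_EFin.
    near=> n; have : u n \is a fin_num by near: n.
    by case: (u n).
  have c : expR (fine (u n)) @[n --> \oo] --> expR r.
    by apply: (@cvg_comp _ _ _ (fine \o u) expR _ (nbhs r)) => //; exact: continuous_expR.
  apply: cvg_trans c; apply: near_eq_cvg; near=> n.
  have : u n \is a fin_num by near: n.
  by rewrite /=; case: (u n).
- move/cvgeNyPlt : ul => ul; apply: cvg_EFin.
    near=> n; have : u n < 0%R%:E by near: n; exact: ul.
    by case: (u n).
  apply/cvgr0Pnorm_lt => e e0; near=> n.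
  have : u n < (ln e)%:E by near: n; exact: ul.
  rewrite -lte_expeR /= lnK ?posrE//; have := expeR_ge0 (u n).
  by case: (u n) => [s| |] //=; rewrite ?lee_fin ?lte_fin ?normr0// => s0; rewrite ger0_norm.
Unshelve. all: by end_near. Qed.

End ExtendedExponential.

(** * Supports of measures and of paths *)

Section Support.
Context {R : realType} {d : nat}.
Local Notation V := 'rV[R]_d.
Local Notation MF := (finite_measures R d).
Implicit Types (nu : MF) (S : R).
Local Open Scope ereal_scope.

(** Finitely many of the null open sets around the points of [K] cover it. *)
Lemma compact_null_off_support nu (K : set V) :
  compact K -> (forall x, K x -> ~ measure_support nu x) -> nu K = 0.
Proof.
move=> cK Knu.
pose D : set (set V) := [set U | open U /\ nu U = 0].
have mK : measurable (K : set (borel V)).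
  by apply: borel_closed; apply: compact_closed => //; exact: norm_hausdorff.
have [D' DD' KD'] : finite_subset_cover D id K.
  have := cK; rewrite compact_cover => /(_ _ D id); apply; first by move=> U [].
  move=> x /Knu xs; have [U HU] : exists U, ~ (open U -> U x -> 0 < nu U).
    exact/existsNP.
  have {HU} [oU [Ux nU]] : open U /\ U x /\ ~ (0 < nu U).
    by move: HU => /not_implyP[? /not_implyP[]].
  exists U => //; split => //; apply/eqP; rewrite eq_le measure_ge0 andbT leNgt.
  exact/negP.
suff : nu.-negligible K by move/negligibleP; exact.
apply: (@negligibleS _ (borel V) R nu _ _ KD'); rewrite /cover bigcup_fset big_seq.
elim/big_ind : _ => [|A B nA nB|U UD'].
- exact: negligible_set0.
- exact: negligibleU.
- have /set_mem [oU nU] := DD' U UD'.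
  by apply/negligibleP => //; exact: borel_open.
Qed.

Definition outer S : set V := [set x | (S < lrho x)%R].

Lemma outer_measurable S : measurable (outer S : set (borel V)).
Proof. by apply: borel_open; exact: open_lrho_gt. Qed.

(** The region [S < lrho x] is exhausted by the shells [S <= lrho x <= n], which
    are compact and miss the support. *)
Lemma outer_null nu (a S : R) : (a < S)%R ->
  (forall x, measure_support nu x -> (lrho x <= a)%R) -> nu (outer S) = 0.
Proof.
move=> aS supp; apply/negligibleP; first exact: outer_measurable.
have : outer S `<=` \bigcup_n [set x | (S <= lrho x <= n%:R)%R].
  move=> x /= Sx; have [n xn] : exists n : nat, (lrho x <= n%:R)%R.
    by exists (Num.bound (lrho x)); rewrite ltW// archi_boundP// lrho_ge0.
  by exists n => //=; rewrite (ltW Sx).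
move=> sub; apply: (@negligibleS _ (borel V) R nu _ _ sub).
apply: (@negligible_bigcup _ (borel V)) => n.
have cK : compact [set x : V | (S <= lrho x <= n%:R)%R].
  apply: (@subclosed_compact _ _ [set x : V | (lrho x <= n%:R)%R]).
  - rewrite (_ : [set x | _] = lrho @^-1` [set y | (S <= y)%R] `&` lrho @^-1` [set y | (y <= n%:R)%R]).
      by apply: closedI; apply: closed_comp => [x _|]; try exact: continuous_lrho;
        [exact: closed_ge|exact: closed_le].
    by apply/seteqP; split => x /=; [move=> /andP[]|move=> [-> ->]].
  - exact: compact_lrho_le.
  - by move=> x /= /andP[].
apply/negligibleP.
  by apply: borel_closed; apply: compact_closed => //; exact: norm_hausdorff.
apply: compact_null_off_support => // x /= /andP[Sx _] /supp; rewrite leNgt.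
by rewrite (lt_le_trans aS Sx).
Qed.

Lemma support_sub_lrho nu S : nu (outer S) = 0 ->
  forall x, measure_support nu x -> (lrho x <= S)%R.
Proof.
move=> nS x nx; rewrite leNgt; apply/negP => Sx.
by have := nx _ (@open_lrho_gt R d S) Sx; rewrite /outer in nS; rewrite nS ltxx.
Qed.

(** A bounded continuous function, positive exactly on [outer S]: it expresses
    that [outer S] is a null set in terms of the weak topology. *)
Definition outer_test S (x : V) : R := (Num.min 1 (Num.max 0 (lrho x - S)))%R.

Lemma outer_test_ge0 S x : (0 <= outer_test S x)%R.
Proof. by rewrite /outer_test le_min ler01 le_max lexx. Qed.

Lemma outer_testE S x : (outer_test S x != 0)%R = (S < lrho x)%R.
Proof.
rewrite /outer_test; have [xS|xS] := leP (lrho x) S.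
  by rewrite max_l ?subr_le0// min_r ?eqxx.
rewrite max_r ?subr_ge0 ?(ltW xS)//; apply/eqP => E.
have : (0 < Num.min 1 (lrho x - S))%R by rewrite lt_min ltr01 subr_gt0.
by rewrite E ltxx.
Qed.

Lemma Cb_outer_test S : Cb (outer_test S).
Proof.
split; last first.
  by exists 1%R => x; rewrite ger0_norm ?outer_test_ge0// ge_min lexx.
move=> x; apply: (@continuous_comp _ _ _ lrho
  (fun y => Num.min 1 (Num.max 0 (y - S)))%R); first exact: continuous_lrho.
apply: (@continuous_min R _ (cst 1%R)); first exact: cst_continuous.
apply: (@continuous_max R _ (cst 0%R) (fun y => y - S)%R); first exact: cst_continuous.
by apply: cvgB; [exact: cvg_id|exact: cvg_cst].
Qed.

Lemma pairing_outer_test nu S : (pairing (outer_test S) nu = 0) <-> (nu (outer S) = 0).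
Proof.
have mt : measurable_fun setT (fun x : borel V => (outer_test S x)%:E).
  by apply/measurable_EFinP; apply: continuous_borel_measurable; exact: (Cb_outer_test S).1.
have -> : pairing (outer_test S) nu = \int[nu]_(x in setT) `|(outer_test S x)%:E|.
  by apply: eq_integral => x _; rewrite gee0_abs ?lee_fin ?outer_test_ge0.
have E : [set x | ~ ((setT : set V) x -> (outer_test S x)%:E = cst 0 x)] = outer S.
  apply/seteqP; split => x; rewrite /outer /= -outer_testE.
    by move=> H; apply/eqP => H0; apply: H => _; rewrite H0.
  by move=> /eqP H H0; apply: H; have [] := H0 I.
split.
  move/(ae_eq_integral_abs nu (@measurableT _ (borel V)) mt) => ae.
  by apply/negligibleP; [exact: outer_measurable|rewrite -E].
move=> n0; apply/(ae_eq_integral_abs nu (@measurableT _ (borel V)) mt).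
rewrite /ae_eq /almost_everywhere/=; apply/negligibleP.
  by rewrite [X in measurable X]E; exact: outer_measurable.
by move: n0; rewrite -E.
Qed.

Lemma dyadic_above (s t e : R) : (0 <= s < t)%R -> (0 < e)%R ->
  exists k j : nat, [/\ (j <= 2 ^ k)%N, (s < j%:R * (t / (2 ^ k)%:R))%R &
     (j%:R * (t / (2 ^ k)%:R) < s + e)%R].
Proof.
move=> /andP[s0 st] e0; have t0 : (0 < t)%R by exact: le_lt_trans st.
pose m := Num.min e (t - s)%R; have m0 : (0 < m)%R by rewrite lt_min e0 subr_gt0.
pose k := Num.bound (t / m)%R.
have k0 : (0 < (2 ^ k)%:R :> R)%R by rewrite ltr0n expn_gt0.
have tk : (t / (2 ^ k)%:R < m)%R.
  rewrite ltr_pdivrMr// mulrC -ltr_pdivrMr//.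
  apply: (@lt_le_trans _ _ k%:R%R); first by rewrite archi_boundP// divr_ge0 ?ltW.
  by rewrite ler_nat ltnW// ltn_expl.
pose h := (t / (2 ^ k)%:R)%R; have h0 : (0 < h)%R by rewrite divr_gt0.
have /andP[j1 j2] := truncn_itv (divr_ge0 s0 (ltW h0)).
set j := Num.truncn (s / h) in j1 j2.
rewrite ler_pdivlMr// in j1; rewrite ltr_pdivrMr// in j2.
have jh : (j.+1%:R * h <= s + h)%R by rewrite -natr1 mulrDl mul1r lerD2r.
have hm : (s + h < s + m)%R by rewrite ltrD2l.
have jm : (j.+1%:R * h < s + m)%R by exact: le_lt_trans hm.
exists k, j.+1; split => //; last first.
  by apply: (lt_le_trans jm); rewrite lerD2l ge_min lexx.
have : (j.+1%:R * h < (2 ^ k)%:R * h)%R.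
  apply: (lt_le_trans jm); rewrite /h [X in (_ <= X)%R]mulrC divfK ?gt_eqF//.
  have : (m <= t - s)%R by rewrite ge_min lexx orbT.
  by rewrite lerBrDl.
by rewrite ltr_pM2r// ltr_nat; exact: ltnW.
Qed.

(** If the outside were charged at a time [s < t], right continuity of
    [<outer_test S, nu_r>] at [s] would make it charged at the dyadic times just
    after [s].  The time [t] itself belongs to the grids. *)
Lemma cadlag_outer_null (nu : R -> MF) S (t : R) : cadlag nu ->
  (forall k j : nat, (j <= 2 ^ k)%N -> nu (j%:R * (t / (2 ^ k)%:R))%R (outer S) = 0) ->
  forall s, (0 <= s <= t)%R -> nu s (outer S) = 0.
Proof.
move=> [nuR _] grid s /andP[s0]; rewrite le_eqVlt => /predU1P[->|st].
  by have := grid 0%N 1%N isT; rewrite expn0 divr1 mul1r.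
apply/pairing_outer_test/eqP; rewrite eq_le [X in _ && X]integral_ge0 ?andbT; last first.
  by move=> x _; rewrite lee_fin outer_test_ge0.
rewrite leNgt; apply/negP => pos.
have near_s : nbhs (pairing (outer_test S) (nu s)) [set y | 0%R < y].
  by apply: open_nbhs_nbhs; split => //; exact: open_ereal_gt_ereal.
have := nuR _ s0 _ (Cb_outer_test S) _ near_s.
move=> [e /= e0 He].
have s0t : (0 <= s < t)%R by rewrite s0.
have [k [j [jk sj je]]] := dyadic_above s0t e0.
have := He (j%:R * (t / (2 ^ k)%:R))%R; rewrite /ball/= distrC gtr0_norm ?subr_gt0//.
rewrite ltrBlDl => /(_ je sj); rewrite (pairing_outer_test _ _).2 ?ltxx//.
exact: grid.
Qed.

End Support.

(** * The compact support property *)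

Section SuperprocessSupport.
Context {R : realType} {d : nat} {dO : measure_display} {Omega : measurableType dO}.
Local Notation V := 'rV[R]_d.
Local Notation MF := (finite_measures R d).
Variables (P : MF -> probability Omega R) (X : R -> Omega -> MF).
Variables (m p c : R) (alpha : V -> R).
Hypotheses (p1 : 1 < p) (c0 : 0 < c).
Hypothesis alpha0 : forall x, 0 < alpha x.
Hypothesis alpha_ge : forall x, c * (1 + enorm x) `^ (m - 2) <= alpha x.
Hypothesis sp : superprocess P X (weighted_laplacian m) (fun=> 0) alpha p.
Implicit Types (nu mu : MF) (S t : R).
Local Open Scope ereal_scope.

Definition barrier_energy S nu : \bar R := \int[nu]_x ebarrier p c S x.

(** A lower bound for the probability that the process started from [nu] never
    charges [outer S]. *)
Definition survival S nu : \bar R := expeR (- barrier_energy S nu).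

Lemma measurable_ebarrier S : (0 < S)%R ->
  measurable_fun setT (ebarrier p c S : borel V -> \bar R).
Proof.
move=> S0; apply: (emeasurable_fun_cvg (fun k (x : borel V) => (barrier_approx p c S k x)%:E)).
  move=> k; apply/measurable_EFinP; apply: continuous_borel_measurable.
  exact: continuous_barrier_approx.
by move=> x _; exact: cvg_barrier_approx.
Qed.

Lemma barrier_energy_ge0 S nu : 0 <= barrier_energy S nu.
Proof. by apply: integral_ge0 => x _; exact: ebarrier_ge0. Qed.

Lemma measurable_survival S : (0 < S)%R -> measurable_fun setT (survival S).
Proof.
move=> S0; apply: measurableT_comp; first exact: measurable_expeR.
apply: measurableT_comp => //; apply: measurable_MF_integral.
  exact: measurable_ebarrier.
by move=> x; exact: ebarrier_ge0.
Qed.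

Lemma survival_ge0 S nu : 0 <= survival S nu.
Proof. exact: expeR_ge0. Qed.

Lemma survival_le1 S nu : survival S nu <= 1.
Proof. by rewrite -[leRHS]expeR0 lee_expeR oppe_le0 barrier_energy_ge0. Qed.

Lemma survival_outer S nu : (0 < S)%R -> nu (outer S) != 0 -> survival S nu = 0.
Proof.
move=> S0 nuS; suff : barrier_energy S nu = +oo by rewrite /survival => ->.
apply/eqP; rewrite -leye_eq.
have mo := outer_measurable (d := d) S.
apply: (@le_trans _ _ (\int[nu]_(x in outer S) (cst +oo x))).
  rewrite integral_cst// gt0_mulye//.
  by rewrite lt0e nuS/= measure_ge0.
apply: (@le_trans _ _ (\int[nu]_(x in outer S) ebarrier p c S x)).
  apply: ge0_le_integral => //.
  - by move=> x _; rewrite /cst leey.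
  - by apply: measurable_funTS; exact: measurable_ebarrier.
  - by move=> x; rewrite /outer /= /ebarrier => xS; rewrite ltNge (ltW xS).
apply: ge0_subset_integral => //; first exact: measurable_ebarrier.
by move=> x _; exact: ebarrier_ge0.
Qed.

Lemma solution_le_ebarrier S k t (u : V -> R -> R) : (0 < S)%R -> (0 <= t)%R ->
  minimal_solution (weighted_laplacian m) (fun=> 0%R) alpha p (barrier_approx p c S k) u ->
  forall x, (u x t)%:E <= ebarrier p c S x.
Proof.
move=> S0 t0 [usol _] x; rewrite /ebarrier; case: ltP => xS; last exact: leey.
rewrite lee_fin; apply: (solution_le_barrier p1 c0 S0 alpha0 alpha_ge usol) => //.
by move=> y yS; exact: barrier_approx_le.
Qed.

(** For the test functions [f_k] increasing to the barrier, the Laplace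
    functional equals [exp (- <u_k (t), nu>)] with [u_k <= ebarrier S], hence is
    at least [survival S nu]; dominated convergence does the rest. *)
Lemma survival_submartingale S t nu : (0 < S)%R -> (0 <= t)%R ->
  survival S nu <= \int[P nu]_w survival S (X t w).
Proof.
move=> S0 t0; pose f : nat -> V -> R := barrier_approx p c S.
have mf k : measurable_fun setT (fun x : borel V => (f k x)%:E).
  apply/measurable_EFinP; apply: continuous_borel_measurable.
  exact: continuous_barrier_approx.
have f0 k x : 0 <= (f k x)%:E by rewrite lee_fin; exact: barrier_approx_ge0.
have mX := superprocess_measurable sp t0.
have mpf k : measurable_fun setT (fun w => expeR (- pairing (f k) (X t w))).
  apply: measurableT_comp; first exact: measurable_expeR.
  apply: measurableT_comp => //.
  apply: (@measurableT_comp _ _ _ _ _ _ (pairing (f k))) => //.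
  exact: measurable_MF_integral.
have pairing_cvg mu : pairing (f k) mu @[k --> \oo] --> barrier_energy S mu.
  have -> : barrier_energy S mu = \int[mu]_x limn (fun k => (f k x)%:E).
    apply: eq_integral => x _; apply/esym/cvg_lim => //.
    exact: cvg_barrier_approx.
  apply: cvg_monotone_convergence => //.
  move=> x _ k l kl; rewrite lee_fin; exact: barrier_approx_nd.
have lower k : survival S nu <= \int[P nu]_w expeR (- pairing (f k) (X t w)).
  have [u umin ->//] := superprocess_Laplace sp (Ccp_barrier_approx p c S k).
  rewrite lee_expeR leeN2; apply: ge0_le_integral => //.
  - by move=> x _; rewrite lee_fin; have [[_ + _ _] _] := umin; apply.
  - have [[[uc _] _ _ _] _] := umin.
    (* joint continuity on the closed half-space gives continuity in [x] alone *)
    apply/measurable_EFinP; apply: continuous_borel_measurable => x.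
    have := uc; rewrite continuous_subspace_in => /(_ (x, t)).
    rewrite inE => /(_ t0) /=; move/subspace_continuousP : uc => /(_ (x, t) t0) uc' _.
    apply: (@cvg_comp _ _ _ (fun y => (y, t)) (fun z => u z.1 z.2) _ _ _ _ uc').
    move=> B; rewrite /within /= => -[[B1 B2] /= [nB1 nB2] BB].
    rewrite /nbhs /=; apply: filterS nB1 => y B1y.
    by apply: (BB (y, t)) => //; split => //=; exact: nbhs_singleton.
  - exact: measurable_ebarrier.
  - by move=> x _; exact: (solution_le_ebarrier S0 t0 umin).
have lim : \int[P nu]_w expeR (- pairing (f k) (X t w)) @[k --> \oo] -->
    \int[P nu]_w survival S (X t w).
  apply: (@dominated_cvg _ _ _ _ _ measurableT _ _ (cst 1)) => //.
  - move=> w _; apply: cvg_expeR; last exact: cvgeN.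
    by rewrite (le_lt_trans _ (ltry 0))// oppe_le0 barrier_energy_ge0.
  - exact: finite_measure_integrable_cst.
  - move=> k w _; rewrite gee0_abs ?expeR_ge0// -[leRHS]expeR0 lee_expeR oppe_le0.
    by apply: integral_ge0 => x _.
rewrite -(cvg_lim _ lim)//; apply: lime_ge; first by apply/cvg_ex; eexists; exact: lim.
by near=> k; exact: lower.
Unshelve. all: by end_near. Qed.

Definition unexited S : set MF := [set nu | nu (outer S) = 0].

Lemma unexited_measurable S : measurable (unexited S).
Proof.
have := measurable_MF_eval (outer_measurable (d := d) S).
move=> /(_ measurableT [set 0] (emeasurable_set1 _)); rewrite setTI; exact.
Qed.

Definition grid_event S (e : R) (j : nat) : set Omega :=
  [set w | forall i : nat, (i <= j)%N -> unexited S (X (i%:R * e)%R w)].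

Lemma grid_event0 S e : grid_event S e 0 = X (0%:R * e)%R @^-1` unexited S.
Proof.
apply/seteqP; split => w /=; first exact.
by move=> H i; rewrite leqn0 => /eqP ->.
Qed.

Lemma grid_eventS S e j :
  grid_event S e j.+1 = grid_event S e j `&` X (j.+1%:R * e)%R @^-1` unexited S.
Proof.
apply/seteqP; split => w.
  by move=> H; split => [i ij|]; apply: H => //; exact: leqW.
move=> [H1 H2] i; rewrite leq_eqVlt => /predU1P[->//|]; rewrite ltnS; exact: H1.
Qed.

Lemma natural_filtration_mono (s t : R) A : (s <= t)%R ->
  natural_filtration X s A -> natural_filtration X t A.
Proof.
move=> st; apply: smallest_sub; first exact: smallest_sigma_algebra.
apply: subset_trans; last exact: sub_gen_smallest.
move=> _ [r [B [/andP[r0 rs] mB ->]]]; exists r, B; split => //.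
by rewrite r0 (le_trans rs).
Qed.

Lemma natural_filtration_grid_event S e j : (0 <= e)%R ->
  natural_filtration X (j%:R * e)%R (grid_event S e j).
Proof.
move=> e0; have gen i : natural_filtration X (i%:R * e)%R (X (i%:R * e)%R @^-1` unexited S).
  apply: sub_gen_smallest; exists (i%:R * e)%R, (unexited S).
  by split => //; [rewrite lexx mulr_ge0|exact: unexited_measurable].
elim: j => [|j IH]; first by rewrite grid_event0.
rewrite grid_eventS; pose F := [set A | exists (r : R) B,
  [/\ (0 <= r <= j.+1%:R * e)%R, measurable B & A = X r @^-1` B]].
apply: (@measurableI _ (g_sigma_algebraType F)); last exact: gen.
apply: natural_filtration_mono IH.
by rewrite ler_wpM2r// ler_nat.
Qed.

Lemma grid_event_measurable S e j : (0 <= e)%R -> measurable (grid_event S e j).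
Proof.
move=> e0; have mpre i : measurable (X (i%:R * e)%R @^-1` unexited S).
  rewrite -[X in measurable X]setTI; apply: (superprocess_measurable sp) => //.
    by rewrite mulr_ge0.
  exact: unexited_measurable.
elim: j => [|j IH]; first by rewrite grid_event0.
by rewrite grid_eventS; exact: measurableI.
Qed.

Lemma integral_survival_unexited S (s : R) mu (A : set Omega) :
  (0 < S)%R -> 
  \int[P mu]_(w in A `&` X s @^-1` unexited S) survival S (X s w) =
  \int[P mu]_(w in A) survival S (X s w).
Proof.
move=> S0; rewrite integral_mkcondr; apply: eq_integral => w _.
rewrite patchE; case: ifPn => //; rewrite notin_setE /= /unexited /= => /eqP nS.
by rewrite survival_outer.
Qed.

(** Since [survival S] vanishes off [unexited S], the expectation of
    [survival S (X s)] restricted to the grid event up to time [s] is unchanged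
    when the constraint at time [s] itself is dropped; the Markov property and
    the submartingale inequality then show that it does not decrease along the
    grid. *)
Lemma survival_le_grid_event S e j mu : (0 < S)%R -> (0 <= e)%R ->
  survival S mu <= P mu (grid_event S e j).
Proof.
move=> S0 e0.
have mh i : measurable_fun setT (fun w => survival S (X (i%:R * e)%R w)).
  apply: (measurableT_comp (measurable_survival S0)).
  by apply: (superprocess_measurable sp); rewrite mulr_ge0.
suff : survival S mu <= \int[P mu]_(w in grid_event S e j) survival S (X (j%:R * e)%R w).
  move=> /le_trans; apply.
  apply: (@le_trans _ _ (\int[P mu]_(w in grid_event S e j) cst 1 w)).
    apply: ge0_le_integral => //.
    - exact: grid_event_measurable.
    - by move=> w _; exact: survival_ge0.
    - apply: measurable_funTS; exact: mh.
    - by move=> w _; exact: survival_le1.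
  by rewrite integral_cst ?mul1e//; exact: grid_event_measurable.
elim: j => [|j IH].
  rewrite grid_event0 -[_ @^-1` _]setTI integral_survival_unexited//.
  by apply: survival_submartingale => //; rewrite mul0r.
apply: (le_trans IH); rewrite grid_eventS integral_survival_unexited//.
have je0 : (0 <= j%:R * e)%R by rewrite mulr_ge0.
have -> : (j.+1%:R * e = j%:R * e + e)%R by rewrite -natr1 mulrDl mul1r.
have mA := grid_event_measurable S j e0.
rewrite (@ge0_integral_disintegration _ _ _ Omega MF (P mu)
  (fun w => P (X (j%:R * e)%R w)) (grid_event S e j) (X e) (X (j%:R * e + e)%R)) //.
- apply: ge0_le_integral => //.
  + by move=> w _; exact: survival_ge0.
  + apply: measurable_funTS; exact: mh.
  + apply: (@measurable_integral_disintegration R _ _ Omega MF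
      (fun w => P (X (j%:R * e)%R w)) (grid_event S e j) (X e)) => //.
    * exact: (superprocess_measurable sp).
    * move=> G mG; apply: measurable_funTS.
      exact: (measurableT_comp (superprocess_kernel sp e0 mG) (superprocess_measurable sp je0)).
    * by move=> nu; exact: survival_ge0.
    * exact: measurable_survival.
  + by move=> w _; exact: survival_submartingale.
- exact: (superprocess_measurable sp).
- by apply: (superprocess_measurable sp); rewrite addr_ge0.
- move=> G mG; apply: measurable_funTS.
  exact: (measurableT_comp (superprocess_kernel sp e0 mG) (superprocess_measurable sp je0)).
- move=> G mG; apply: (superprocess_Markov sp) => //.
  exact: natural_filtration_grid_event.
- by move=> nu; exact: survival_ge0.
- exact: measurable_survival.
Qed.

(** Only countably many times enter, so this is an event; by right continuity
    it prescribes what happens at all times of [[0, t]] ([confined_eventP]). *)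
Definition confined_event S t : set Omega :=
  \bigcap_k grid_event S (t / (2 ^ k)%:R) (2 ^ k)%N.

Lemma confined_event_measurable S t : (0 <= t)%R -> measurable (confined_event S t).
Proof.
by move=> t0; apply: bigcap_measurable => // k _; apply: grid_event_measurable; rewrite divr_ge0.
Qed.

Lemma survival_le_confined S t mu : (0 < S)%R -> (0 <= t)%R ->
  survival S mu <= P mu (confined_event S t).
Proof.
move=> S0 t0; pose F k := grid_event S (t / (2 ^ k)%:R) (2 ^ k)%N.
have e0 k : (0 <= t / (2 ^ k)%:R)%R by rewrite divr_ge0.
have mF k : measurable (F k) by apply: grid_event_measurable.
have Fc : P mu (F k) @[k --> \oo] --> P mu (confined_event S t).
  apply: nonincreasing_cvg_mu => //.
  - by rewrite (le_lt_trans (probability_le1 _ _)) ?ltry.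
  - exact: confined_event_measurable.
  - apply/nonincreasing_seqP => k; apply/subsetPset => w Fw i ik.
    have k0 : ((2 ^ k)%:R != 0 :> R)%R by rewrite pnatr_eq0 expn_eq0.
    (* each dyadic grid contains the previous one *)
    have -> : (i%:R * (t / (2 ^ k)%:R) = (2 * i)%:R * (t / (2 ^ k.+1)%:R))%R.
      by rewrite expnS !natrM; field.
    by apply: Fw; rewrite expnS leq_mul2l ik.
rewrite -(cvg_lim _ Fc)//; apply: lime_ge; first by apply/cvg_ex; eexists; exact: Fc.
by apply: nearW => k; exact: survival_le_grid_event.
Qed.

Lemma confined_eventP S t w : (0 <= t)%R -> confined_event S t w <->
  (forall s, (0 <= s <= t)%R -> X s w (outer S) = 0).
Proof.
move=> t0; split.
  move=> Fw; apply: (cadlag_outer_null (superprocess_cadlag sp w)) => k j jk.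
  exact: Fw.
move=> H k _ i ik; apply: H; rewrite mulr_ge0 ?divr_ge0//=.
rewrite mulrCA ler_piMr//.
by rewrite ler_pdivrMr ?mul1r ?ler_nat// ltr0n expn_gt0.
Qed.

Lemma bounded_support_confined t : (0 <= t)%R ->
  [set w | bounded_set (\bigcup_(s in `[0%R, t]) measure_support (X s w))] =
  \bigcup_n confined_event n.+1%:R t.
Proof.
move=> t0; apply/seteqP; split => w /=.
  move=> [M [Mreal HM]].
  pose M' := (Num.max M 0 + 1)%R.
  have MM' : (M < M')%R by rewrite /M'; have : (M <= Num.max M 0)%R by [rewrite le_max lexx]; lra.
  pose a := ln (1 + d%:R * M' ^+ 2)%R.
  have supp s x : (0 <= s <= t)%R -> measure_support (X s w) x -> (lrho x <= a)%R.
    move=> st xs; apply: lrho_le_norm; apply: (HM M' MM') => //.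
    by exists s => //=; rewrite in_itv.
  exists (Num.bound `|a|%R) => //; apply/confined_eventP => // s st.
  apply: (outer_null (a := a)); last by move=> x; exact: supp.
  apply: (le_lt_trans (ler_norm a)); apply: (lt_trans (archi_boundP (normr_ge0 a))).
  by rewrite ltr_nat.
move=> [n _ /confined_eventP - /(_ t0) H].
exists (expR n.+1%:R); split; first exact: num_real.
move=> M nM x [s /=]; rewrite in_itv /= => st xs.
have xn := support_sub_lrho (H _ st) xs.
apply: (le_trans (norm_le_enorm x)); apply: (le_trans _ (ltW nM)).
apply: (le_trans (enorm_le_rho x)).
by rewrite -(lnK (rho_gt0 x)) ler_expR.
Qed.

(** Let [a] bound [lrho] on the support of [mu], up to a margin.  For large [S]
    the barrier is at most [e] on [lrho x <= a], so the event has probability at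
    least [exp (- e mu(R^d))], for every [e > 0]. *)
Lemma superprocess_compact_support : compact_support_property P X.
Proof.
move=> mu _ cmu t t0; rewrite bounded_support_confined//.
set B := \bigcup_n _.
have mF n : measurable (confined_event n.+1%:R t) by exact: confined_event_measurable.
have mB : measurable B by exact: bigcupT_measurable.
have [a0 a00 supp] : exists2 a : R, (0 <= a)%R &
    forall x, measure_support mu x -> (lrho x <= a)%R.
  have [M [Mreal HM]] := compact_bounded cmu.
  exists (Num.max 0 (ln (1 + d%:R * (M + 1) ^+ 2)))%R; first by rewrite le_max lexx.
  move=> x xmu; rewrite le_max; apply/orP; right; apply: lrho_le_norm.
  by apply: (HM (M + 1)%R) => //; lra.
pose a := (a0 + 1)%R.
have mua : mu (outer a) = 0 by apply: outer_null supp; rewrite /a; lra.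
have a_ge0 : (0 <= a)%R by rewrite /a; lra.
have fmu : mu setT \is a fin_num by exact: fin_num_measure.
pose M := fine (mu setT).
have energy (e : R) : (0 < e)%R -> exists n : nat, barrier_energy n.+1%:R mu <= (e * M)%:E.
  move=> e0; have [n Hn] : exists n : nat, forall x : V, (lrho x <= a)%R ->
      (lrho x < n.+1%:R)%R /\ (barrier p c n.+1%:R x <= e)%R.
    have [T [Treal HT]] := @barrier_vanishes R d p c p1 c0 a e a_ge0 e0.
    pose T' := Num.max `|T|%R a.
    have T'0 : (0 <= T')%R by rewrite le_max normr_ge0.
    exists (Num.bound T') => x xa.
    have bT : (T' < (Num.bound T').+1%:R)%R.
      by apply: (lt_trans (archi_boundP T'0)); rewrite ltr_nat.
    split; first by apply: (le_lt_trans xa); apply: le_lt_trans bT; rewrite le_max lexx orbT.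
    apply: HT => //; apply: le_lt_trans bT; rewrite le_max; apply/orP; left.
    exact: ler_norm.
  exists n; rewrite /barrier_energy.
  have n0 : (0 < n.+1%:R :> R)%R by rewrite ltr0n.
  apply: (@le_trans _ _ (\int[mu]_x (cst e%:E x))).
    apply: ae_ge0_le_integral => //.
    - by move=> x _; exact: ebarrier_ge0.
    - exact: measurable_ebarrier.
    - by move=> x _; rewrite lee_fin ltW.
    - exists (outer a); split => //; first exact: outer_measurable.
      move=> x /= H; rewrite /outer /= ltNge; apply/negP => xa; apply: H => _.
      by have [xn xe] := Hn _ xa; rewrite /ebarrier xn lee_fin.
  by rewrite integral_cst// EFinM /M fineK.
have PB1 : P mu B <= 1 by exact: probability_le1.
have PBfin : P mu B \is a fin_num by rewrite fin_num_measure.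
apply/eqP; rewrite eq_le PB1 /=; rewrite -(fineK PBfin) lee_fin.
set b := fine _.
have M0 : (0 <= M)%R by rewrite fine_ge0.
apply/ler_addgt0Pr => e e0.
have e1 : (0 < e / (M + 1))%R by rewrite divr_gt0// ltr_wpDl.
have [n Hn] := energy _ e1.
have : expeR (- (e / (M + 1) * M)%:E) <= P mu B.
  apply: (@le_trans _ _ (survival n.+1%:R mu)); first by rewrite lee_expeR leeN2.
  apply: le_trans (_ : _ <= P mu (confined_event n.+1%:R t)) _.
    by apply: survival_le_confined; rewrite ?ltr0n.
  apply: le_measure; [by rewrite inE; exact: mF|by rewrite inE|].
  by move=> w Fw; exists n.
rewrite -(fineK PBfin) -/b /= lee_fin.
have h1 := expR_ge1Dx (- (e / (M + 1) * M))%R.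
have h2 : (e / (M + 1) * M <= e)%R.
  by rewrite mulrAC ler_pdivrMr ?ltr_wpDl// ler_pM2l// lerDl.
lra.
Qed.

End SuperprocessSupport.

(** * Explosion *)

Section RadialPower.
Context {R : realType} {d : nat}.
Implicit Types (x : 'rV[R]_d) (H : R -> R).

Lemma partial_radial H H1 : (forall z : R, 0 < z -> is_derive z 1 H (H1 z)) ->
  forall i : 'I_d, partial i (fun x => H (rho x)) = fun x => 2 * x 0 i * H1 (rho x).
Proof.
move=> HH i; apply/funext => x.
by rewrite /partial; have [_ ->] := is_derive_radial i (HH _ (rho_gt0 x)).
Qed.

Lemma partial_radial2 H H1 H2 : (forall z : R, 0 < z -> is_derive z 1 H (H1 z)) ->
  (forall z : R, 0 < z -> is_derive z 1 H1 (H2 z)) ->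
  forall i j : 'I_d, partial j (partial i (fun x => H (rho x))) =
    fun x => 2 * (j == i)%:R * H1 (rho x) + 4 * x 0 i * x 0 j * H2 (rho x).
Proof.
move=> HH HH1 i j; rewrite (partial_radial HH); apply/funext => x.
by rewrite /partial; have [_ ->] := is_derive_radial2 i j (HH1 _ (rho_gt0 x)).
Qed.

Let continuous_comp_rho H : (forall z : R, 0 < z -> {for z, continuous H}) ->
  continuous (fun x => H (rho x)).
Proof.
move=> cH x; apply: (@continuous_comp _ _ _ rho H); first exact: continuous_rho.
exact/cH/rho_gt0.
Qed.

Let is_derive_continuous H (z dH : R) : is_derive z 1 H dH -> {for z, continuous H}.
Proof. by case=> D _; apply: differentiable_continuous; exact/derivable1_diffP. Qed.

Lemma C2_radial H H1 H2 : (forall z : R, 0 < z -> is_derive z 1 H (H1 z)) ->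
  (forall z : R, 0 < z -> is_derive z 1 H1 (H2 z)) ->
  (forall z : R, 0 < z -> {for z, continuous H2}) ->
  C2 (fun x => H (rho x)).
Proof.
move=> HH HH1 cH2.
have cc (i : 'I_d) : continuous (fun x => x 0 i) by exact: coord_continuous.
have cH : continuous (fun x => H (rho x)).
  by apply: continuous_comp_rho => z z0; exact: is_derive_continuous (HH z z0).
have cH1 : continuous (fun x => H1 (rho x)).
  by apply: continuous_comp_rho => z z0; exact: is_derive_continuous (HH1 z z0).
have cH2' := continuous_comp_rho cH2.
split => //.
- by move=> i x; have [] := is_derive_radial i (HH _ (rho_gt0 x)).
- move=> i; rewrite (partial_radial HH) => x.
  exact: (cvgM (cvgM (cvg_cst _) (cc i x)) (cH1 x)).
- move=> i j x; rewrite (partial_radial HH).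
  by have [] := is_derive_radial2 i j (HH1 _ (rho_gt0 x)).
- move=> i j; rewrite (partial_radial2 HH HH1) => x.
  exact: (cvgD (cvgM (cvg_cst _) (cH1 x))
    (cvgM (cvgM (cvgM (cvg_cst _) (cc i x)) (cc j x)) (cH2' x))).
Qed.

Lemma laplacian_radial H H1 H2 : (forall z : R, 0 < z -> is_derive z 1 H (H1 z)) ->
  (forall z : R, 0 < z -> is_derive z 1 H1 (H2 z)) ->
  forall x, laplacian (fun y => H (rho y)) x =
    d%:R * (2 * H1 (rho x)) + 4 * (rho x - 1) * H2 (rho x).
Proof.
move=> HH HH1 x; rewrite /laplacian -radial_laplacian_sum.
apply: eq_bigr => i _; rewrite (partial_radial2 HH HH1) eqxx mulr1.
by rewrite expr2 !mulrA.
Qed.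

Variable gam : R.

Definition radial_power x : R := rho x `^ (- gam).

Let H1 (z : R) := - gam * z `^ (- gam - 1).
Let H2 (z : R) := - gam * ((- gam - 1) * z `^ (- gam - 1 - 1)).

Let dH (z : R) : 0 < z -> is_derive z 1 (fun z => z `^ (- gam)) (H1 z).
Proof. exact: is_derive1_powR. Qed.

Let dH1 (z : R) : 0 < z -> is_derive z 1 H1 (H2 z).
Proof.
move=> z0; have D := is_derive1_powR (- gam - 1) z0.
have -> : H1 = (- gam) *: (fun z => z `^ (- gam - 1)) by apply/funext.
exact: is_deriveZ.
Qed.

Let continuous_H2 (z : R) : 0 < z -> {for z, continuous H2}.
Proof.
move=> z0; have D := is_derive1_powR (- gam - 1 - 1) z0.
apply: (is_derive_continuous (dH := - gam * (- gam - 1) *: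
  ((- gam - 1 - 1) * z `^ (- gam - 1 - 1 - 1)))).
have -> : H2 = (- gam * (- gam - 1)) *: (fun z => z `^ (- gam - 1 - 1)).
  by apply/funext => y; rewrite /H2 mulrA.
exact: is_deriveZ.
Qed.

Lemma C2_radial_power : C2 radial_power.
Proof. exact: C2_radial dH dH1 continuous_H2. Qed.

Lemma radial_power_ge0 x : 0 <= radial_power x.
Proof. exact: powR_ge0. Qed.

Lemma radial_power_le1 x : 0 <= gam -> radial_power x <= 1.
Proof.
move=> g0; rewrite /radial_power powRN invf_le1 ?powR_gt0 ?rho_gt0//.
apply: (@le_trans _ _ (1 `^ gam)); first by rewrite powR1.
by rewrite ge0_ler_powR ?nnegrE ?rho_ge1// ltW// rho_gt0.
Qed.

(** The Laplacian of [rho ^ (- gam)] is at most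
    [2 gam rho ^ (- gam - 1) (2 (gam + 1) - d)], where the last factor is at most
    [- 1 / 2]; this is where dimension three enters.  The condition
    [2 gam <= m - 2] lets the weight absorb the remaining decay. *)
Lemma weighted_laplacian_radial_power_le (m : R) x :
  (3 <= d)%N -> 0 < gam -> gam <= 4^-1 -> gam <= (m - 2) / 2 ->
  weighted_laplacian m radial_power x <= - gam.
Proof.
move=> d3 g0 g4 gm; rewrite /weighted_laplacian (laplacian_radial dH dH1).
have z1 := rho_ge1 x; have z0 := rho_gt0 x; set z := rho x in z1 z0 *.
pose Q := z `^ (- gam - 1).
have Q0 : 0 <= Q by exact: powR_ge0.
have -> : H2 z = gam * (gam + 1) * (Q * z^-1).
  by rewrite /H2 [X in _ * (_ * X)]powRB ?(gt_eqF z0) ?implybT// powRr1 ?(ltW z0)//; rewrite /Q; ring.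
have d3' : 3 <= d%:R :> R by rewrite (ler_nat R 3 d).
have lap : d%:R * (2 * H1 z) + 4 * (z - 1) * (gam * (gam + 1) * (Q * z^-1)) <= - gam * Q.
  have -> : d%:R * (2 * H1 z) + 4 * (z - 1) * (gam * (gam + 1) * (Q * z^-1)) =
      gam * Q * (- (2 * d%:R) + 4 * (gam + 1) * (1 - z^-1)).
    by rewrite /H1 -/Q; field; rewrite gt_eqF.
  have zV0 : 0 <= z^-1 by rewrite invr_ge0 ltW.
  rewrite [leRHS]mulNr -[leRHS]mulrN1; apply: ler_wpM2l; first by rewrite mulr_ge0// ltW.
  have : 4 * (gam + 1) * (1 - z^-1) <= 4 * (gam + 1) * 1.
    by apply: ler_wpM2l; lra.
  lra.
have e1 : 1 <= 1 + enorm x by rewrite lerDl enorm_ge0.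
apply: (@le_trans _ _ ((1 + enorm x) `^ m * (- gam * Q))).
  by rewrite ler_wpM2l ?powR_ge0.
rewrite mulrCA -[leRHS]mulr1 ler_wnM2l ?oppr_le0 ?(ltW g0)//.
have m0 : 0 <= m / 2 by lra.
apply: (@le_trans _ _ (z `^ (m / 2) * Q)).
  rewrite /Q -powRD ?(gt_eqF z0) ?implybT//.
  rewrite -[leLHS](powRr0 z) ler_powR//; lra.
rewrite ler_wpM2r//.
have -> : (1 + enorm x) `^ m = ((1 + enorm x) ^+ 2) `^ (m / 2).
  rewrite -powR_mulrn -?powRrM; last by rewrite (le_trans ler01).
  by congr (_ `^ _); field.
by rewrite ge0_ler_powR ?nnegrE ?sqr_ge0 ?rho_le_sqr// ltW.
Qed.

Lemma continuous_weighted_laplacian_radial_power (m : R) :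
  continuous (weighted_laplacian m radial_power).
Proof.
have -> : weighted_laplacian m radial_power = fun x => (1 + enorm x) `^ m *
    (d%:R * (2 * H1 (rho x)) + 4 * (rho x - 1) * H2 (rho x)).
  by apply/funext => x; rewrite /weighted_laplacian (laplacian_radial dH dH1).
move=> x.
have ce : {for x, continuous (fun x => (1 + enorm x) `^ m)}.
  apply: (@continuous_comp _ _ _ (fun y : 'rV[R]_d => 1 + enorm y) (fun z => z `^ m)).
    have ce := @continuous_enorm R d x.
    exact: (cvgD (cvg_cst (1 : R)) ce).
  have e0 : 0 < 1 + enorm x by rewrite ltr_pwDl// enorm_ge0.
  exact: (is_derive_continuous (is_derive1_powR m e0)).
have c1 := @continuous_comp_rho H1 (fun z z0 => is_derive_continuous (dH1 z0)) x.
have c2 := continuous_comp_rho continuous_H2 (x := x).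
have cr := @continuous_rho R d x.
exact: (cvgM ce (cvgD (cvgM (cvg_cst _) (cvgM (cvg_cst _) c1))
  (cvgM (cvgM (cvg_cst _) (cvgB cr (cvg_cst _))) c2))).
Qed.

End RadialPower.

Section Explosion.
Context {R : realType} {d : nat} {dO : measure_display} {Omega : measurableType dO}.
Local Notation V := 'rV[R]_d.
Local Notation E := (one_point_compactification 'rV[R]_d).
Variables (P : V -> probability Omega R) (Y : R -> Omega -> E).
Variable L : (V -> R) -> V -> R.
Hypothesis dY : diffusion P Y L.
Implicit Types (w : Omega) (s t : R).

Definition alive w : Prop := forall t, 0 <= t -> Y t w <> None.

(* the default value 0 is not taken at nonnegative times of an alive path *)
Let position w (s : R) : V := if Y s w is Some x then x else 0.

Let positionE w s : alive w -> 0 <= s -> Y s w = Some (position w s).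
Proof. by move=> /(_ s) aw /aw; rewrite /position; case: (Y s w). Qed.

Let position_continuous w t : alive w -> {within `[0, t], continuous (position w)}.
Proof.
move=> aw; apply: (@continuous_subspaceW _ _ _ [set s : R | 0 <= s]).
  by move=> s /=; rewrite in_itv /= => /andP[].
apply/subspace_continuousP => s /= s0 U nU.
have : {within [set r : R | 0 <= r], continuous (Y^~ w)} by case: dY.
move=> /subspace_continuousP /(_ s s0).
have HU : nbhs (Y s w) (Some @` U).
  by rewrite (positionE aw s0); exact: one_point_compactification_some_nbhs.
move=> /(_ _ HU).
move=> YU.
have {}YU : \forall r \near s, 0 <= r -> (Some @` U) (Y r w) by exact: YU.
suff : \forall r \near s, 0 <= r -> U (position w r) by [].
apply: filterS YU => r YU r0.
by have [x Ux] := YU r0; rewrite (positionE aw r0) => -[<-].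
Qed.

Lemma exit_time_ge0 n w : (0 <= exit_time Y n w)%E.
Proof. by apply: le_ereal_inf_tmp => _ [s [s0 _] <-]; rewrite lee_fin. Qed.

Lemma exit_time_nd w : nondecreasing_seq (fun n => exit_time Y n w).
Proof.
move=> a b ab; apply: ereal_inf_le_tmp => _ [s [s0 sb] <-]; exists s => //; split => //.
by apply: le_trans sb; rewrite lee_fin ler_nat.
Qed.

(** A path that avoids the cemetery is continuous in [R^d], hence bounded on
    [[0, t]]. *)
Lemma alive_exit_time w t : alive w -> 0 <= t ->
  \forall n \near \oo, (t%:E <= exit_time Y n w)%E.
Proof.
move=> aw t0.
have ct : {within `[0, t], continuous (fun s => enorm (position w s))}.
  apply: (@within_continuous_comp _ _ _ _ (position w) (@enorm R d)).
    by move=> x _; exact: continuous_enorm.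
  exact: position_continuous.
have [|s0 _ H] := @compact_EVT_max _ _ _ _ _ (@segment_compact R 0 t) ct.
  by exists 0; rewrite /= in_itv /= lexx.
near=> n; apply: le_ereal_inf_tmp => _ [s [s_ge0 sn] <-]; rewrite lee_fin leNgt.
apply/negP => st; move: sn; rewrite (positionE aw s_ge0) /= lee_fin leNgt => /negP; apply.
apply: (@le_lt_trans _ _ (enorm (position w s0))).
  by apply: H; rewrite inE /= in_itv /= s_ge0 ltW.
by near: n; exact: nbhs_infty_gtr.
Unshelve. all: by end_near. Qed.

(** As the cemetery absorbs, explosion is detected at integer times; this makes
    it an event. *)
Lemma lifetime_lty w : (lifetime Y w < +oo)%E <-> exists N : nat, Y N%:R w = None.
Proof.
split.
  move=> lw; apply: contrapT => nN.
  have aw : alive w.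
    move=> t t0 Yt; apply: nN; exists (Num.bound t).
    by apply: (diffusion_absorbed dY _ Yt); rewrite t0 ltW// archi_boundP.
  suff : lifetime Y w = +oo%E by move=> lE; rewrite lE ltxx in lw.
  apply: cvg_lim => //; apply/cvgeyPge => A.
  have := alive_exit_time aw (normr_ge0 A); apply: filterS => n; apply: le_trans.
  by rewrite lee_fin ler_norm.
move=> [N YN]; apply: (@le_lt_trans _ _ N%:R%:E); last exact: ltry.
apply: lime_le; first by apply: ereal_nondecreasing_is_cvgn; exact: exit_time_nd.
by apply: nearW => n; apply: ereal_inf_lbound; exists N%:R => //=; split; [exact: ler0n|rewrite YN leey].
Qed.

Lemma ae_alive x : P x [set w | (lifetime Y w < +oo)%E] = 0%E -> {ae P x, forall w, alive w}.
Proof.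
set D := [set w | _] => PD.
have DE : D = \bigcup_N (Y N%:R @^-1` [set None]).
  apply/seteqP; split => w /=; first by move/lifetime_lty => [N YN]; exists N.
  by move=> [N _ /= YN]; apply/lifetime_lty; exists N.
have mN : measurable ([set None] : set (borel E)).
  apply: borel_closed; rewrite -[[set None]]setCK; apply: open_closedC.
  rewrite (_ : ~` _ = Some @` setT).
    by apply: one_point_compactification_open_some; exact: openT.
  apply/seteqP; split => -[y|] //=; first by move=> _; exists y.
  by move=> [].
exists D; split => //.
  rewrite DE; apply: bigcupT_measurable => N; rewrite -[X in measurable X]setTI.
  exact: (diffusion_measurable dY).
move=> w /= naw; apply: contrapT => nD; apply: naw => t t0 Yt.
apply: nD; apply/lifetime_lty; exists (Num.bound t).
by apply: (diffusion_absorbed dY _ Yt); rewrite t0 ltW// archi_boundP.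
Qed.

(** If the lifetime were almost surely infinite, the nonnegative variables
    [M n t = g (Y (t /\ tau_n)) - \int_0^(t /\ tau_n) L g (Y r) dr], whose mean is
    that of [M n 0] and thus at most 1, would almost surely be at least [eta t]
    for all large [n]; Fatou's lemma then gives [eta t <= 1], which fails for
    [t = 2 / eta]. *)
Lemma lyapunov_explosive (g : V -> R) (eta : R) : C2 g ->
  (forall x, 0 <= g x <= 1) -> 0 < eta -> (forall x, L g x <= - eta) ->
  continuous (L g) -> explosive P Y.
Proof.
move=> C2g g01 eta0 Lg cLg [x Px].
have aeY := ae_alive Px.
pose t : R := 2 / eta; have t0 : 0 <= t by rewrite divr_ge0// ltW.
pose M n (s : R) w := extend g (Y (stopped_time Y n s w) w) -
  \int[lebesgue_measure]_(r in `[0, stopped_time Y n s w]) extend (L g) (Y r w).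
have mart n := diffusion_martingale dY x n C2g.
have eg01 y : 0 <= extend g y <= 1 by case: y => [y|] /=; rewrite ?g01// lexx ler01.
have eL0 y : extend (L g) y <= 0.
  by case: y => [y|] //=; apply: (le_trans (Lg y)); rewrite oppr_le0 ltW.
have M_ge0 n s w : 0 <= M n s w.
  rewrite subr_ge0; case/andP: (eg01 (Y (stopped_time Y n s w) w)) => g0 _.
  apply: le_trans g0; rewrite /Rintegral fine_le0// integralE.
  rewrite [X in (X - _)%E]integral0_eq ?sub0e ?oppe_le0 ?integral_ge0//.
  by move=> r _; rewrite funeposE max_r// lee_fin.
have M0_le1 n w : M n 0 w <= 1.
  rewrite /M; have -> : stopped_time Y n 0 w = 0.
    by rewrite /stopped_time min_l// exit_time_ge0.
  rewrite set_itv1 Rintegral_set1 subr0.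
  by case/andP: (eg01 (Y 0 w)).
have mM n s : 0 <= s -> measurable_fun setT (fun w => (M n s w)%:E).
  move=> s0; have [/(_ s s0)[iM _] _] := mart n.
  exact: measurable_int iM.
have EM n : (\int[P x]_w (M n t w)%:E <= 1)%E.
  have [_ /(_ 0 t setT)] := mart n; rewrite lexx t0 => -> //.
    rewrite -[leRHS](probability_setT (P x)) -[leRHS]mul1e -integral_cst//.
    apply: ge0_le_integral => //.
    - by move=> w _; rewrite lee_fin; exact: M_ge0.
    - exact: mM.
    - by move=> w _; rewrite lee_fin; exact: M0_le1.
  exact: (@measurableT _ (g_sigma_algebraType [set A | exists (r : R) B,
    [/\ 0 <= r <= 0, measurable B & A = (Y : R -> Omega -> borel E) r @^-1` B]])).
have Mt w : alive w -> \forall n \near \oo, ((eta * t)%:E <= (M n t w)%:E)%E.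
  move=> aw; have := alive_exit_time aw t0; apply: filterS => n tn.
  rewrite lee_fin /M; have -> : stopped_time Y n t w = t.
    by rewrite /stopped_time min_l.
  have cL : {within `[0, t], continuous (fun r => L g (position w r))}.
    apply: (@within_continuous_comp _ _ _ _ (position w) (L g)).
      by move=> y _; exact: cLg.
    exact: position_continuous.
  have -> : \int[lebesgue_measure]_(r in `[0, t]) extend (L g) (Y r w) =
      \int[lebesgue_measure]_(r in `[0, t]) L g (position w r).
    congr fine; apply: eq_integral => r; rewrite inE /= in_itv /= => /andP[r0 _].
    by rewrite (positionE aw r0).
  have : \int[lebesgue_measure]_(r in `[0, t]) L g (position w r) <= - eta * t.
    have tE : t = fine (lebesgue_measure `[0, t]%classic).
      rewrite lebesgue_measure_itv /= lte_fin; case: ltP => [_|t0']; first by rewrite oppr0 addr0.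
      by apply/eqP; rewrite eq_le t0 t0'.
    rewrite [X in _ <= _ * X]tE -Rintegral_cst//.
    apply: le_Rintegral => //.
    - apply: continuous_compact_integrable => //; exact: segment_compact.
    - apply: continuous_compact_integrable; first exact: segment_compact.
      by apply: continuous_subspaceT => z; exact: cvg_cst.
  case/andP: (eg01 (Y t w)) => g0 _; rewrite mulNr; lra.
have : ((eta * t)%:E <= 1)%E.
  apply: (@le_trans _ _ (limn_einf (fun n => \int[P x]_w (M n t w)%:E)%E)); last first.
    rewrite limn_einf_lim; apply: lime_le; first exact: is_cvg_einfs.
    apply: nearW => n; apply: le_trans (EM n); apply: ereal_inf_lbound.
    by exists n => /=.
  apply: (le_trans _ (fatou (P x) measurableT _ _)); last 2 first.
  - by move=> n; exact: mM.
  - by move=> n w _; rewrite lee_fin; exact: M_ge0.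
  rewrite -[leLHS]mule1 -[X in (_ * X)%E](probability_setT (P x)) -integral_cst//.
  apply: ae_ge0_le_integral => //.
  - by move=> w _; rewrite lee_fin mulr_ge0// ltW.
  - move=> w _; rewrite limn_einf_lim; apply: lime_ge; first exact: is_cvg_einfs.
    by apply: nearW => n; apply: le_ereal_inf_tmp => _ [k _ <-]; rewrite lee_fin.
  - apply: (emeasurable_fun_cvg (fun n w => einfs (fun k => (M k t w)%:E) n)).
      by apply: measurable_fun_einfs => n; exact: mM.
    by move=> w _; rewrite limn_einf_lim; exact: is_cvg_einfs.
  - apply: filterS aeY => w aw _; rewrite limn_einf_lim.
    have [N _ HN] := Mt w aw.
    apply: lime_ge; first exact: is_cvg_einfs.
    exists N => // n /= Nn; apply: le_ereal_inf_tmp => _ [k nk <-].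
    by apply: HN; exact: leq_trans nk.
by rewrite lee_fin /t mulrC divfK ?gt_eqF//; lra.
Qed.

End Explosion.
Unset Implicit Arguments.

Theorem proposition1 (R : realType) (d : nat) (hd : (1 <= d)%N)
    (p m c : R) (alpha : 'rV[R]_d -> R)
    (hp : 1 < p <= 2)
    (alpha_gt0 : forall x, 0 < alpha x)
    (alpha_Hoelder : locally_Hoelder alpha)
    (c_gt0 : 0 < c)
    (alpha_ge : forall x, c * (1 + enorm x) `^ (m - 2) <= alpha x) :
  (forall (dO : measure_display) (Omega : measurableType dO)
      (P : finite_measures R d -> probability Omega R)
      (X : R -> Omega -> finite_measures R d),
    superprocess P X (weighted_laplacian m) (fun=> 0) alpha p ->
    compact_support_property P X) /\
  (2 < m -> (3 <= d)%N ->
    forall (dO : measure_display) (Omega : measurableType dO)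
      (P : 'rV[R]_d -> probability Omega R)
      (Y : R -> Omega -> one_point_compactification 'rV[R]_d),
    diffusion P Y (weighted_laplacian m) ->
    explosive P Y).
Proof.
have /andP[p1 _] := hp.
split=> [dO Omega P X sp|m2 d3 dO Omega P Y dY].
  exact: (superprocess_compact_support p1 c_gt0 alpha_gt0 alpha_ge sp).
pose gam : R := Num.min 4^-1 ((m - 2) / 2).
have gam0 : 0 < gam by rewrite lt_min invr_gt0 ltr0n divr_gt0// subr_gt0.
have gam4 : gam <= 4^-1 by rewrite ge_min lexx.
have gamm : gam <= (m - 2) / 2 by rewrite ge_min lexx orbT.
apply: (lyapunov_explosive dY (C2_radial_power gam) _ gam0).
- by move=> x; rewrite radial_power_ge0 radial_power_le1// ltW.
- by move=> x; exact: weighted_laplacian_radial_power_le.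
- exact: continuous_weighted_laplacian_radial_power.
Qed.
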